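(* A set $H\subseteq\mathbb{N}$ is a vdC set if and only if it is $\mathbb{Z}_2$-u.d.vdC, where $\mathbb{Z}_2$ is the group with two elements (with the discrete topology).
   Context: $\mathbb{N}=\{1,2,\dots\}$, $\mathbb{T}=\mathbb{R}/\mathbb{Z}$ with Lebesgue (Haar) probability measure $m$. A sequence $(x_n)_{n\in\mathbb{N}}$ in $\mathbb{T}$ is u.d. mod $1$ if $\lim_{N\to\infty}\frac1N\sum_{n=1}^Nf(x_n)=\int_{\mathbb{T}}f\,dm$ for every continuous $f:\mathbb{T}\to\mathbb{C}$. A set $H\subseteq\mathbb{N}$ is a van der Corput set (vdC set) if, for any sequence $(x_n)_{n\in\mathbb{N}}$ in $\mathbb{T}$ such that $(x_{n+h}-x_n)_{n\in\mathbb{N}}$ is u.d. mod $1$ for all $h\in H$, the sequence $(x_n)_{n\in\mathbb{N}}$ is itself u.d. mod $1$. A sequence $(x_n)_{n\in\mathbb{N}}$ in a compact topological group $G$ with (normalized) Haar measure $\mu_G$ is u.d. in $G$ if $\lim_{N}\frac{1}{N}|\{n\in\{1,\dots,N\}:x_n\in C\}|=\mu_G(C)$ for all open sets $C\subseteq G$ with boundary of measure $0$. A set $H\subseteq\mathbb{N}$ is $G$-u.d.vdC if for any sequence $(x_n)_{n\in\mathbb{N}}$ in $G$ such that $(x_{n+h}x_n^{-1})_{n\in\mathbb{N}}$ is u.d. in $G$ for all $h\in H$, the sequence $(x_n)_{n\in\mathbb{N}}$ is also u.d. in $G$. *)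

(* Defs.v *)
From HB Require Import structures.
From mathcomp Require Import all_boot all_order all_algebra.
From mathcomp Require Import finmap ring_quotient complex.
From mathcomp Require Import all_classical all_reals all_analysis.
From mathcomp Require Import measurable_realfun.

Set Implicit Arguments.
Unset Strict Implicit.
Unset Printing Implicit Defensive.

Import Order.TTheory GRing.Theory Num.Theory.
Import numFieldNormedType.Exports.

Local Open Scope classical_set_scope.
Local Open Scope ring_scope.
Local Open Scope quotient_scope.

(* Sequences indexed by {1, 2, ...} are functions on [nat] whose value at 0 is
   irrelevant: every average below runs over 1 <= n <= N. *)

Notation borel T := (g_sigma_algebraType (@open T)).

Section circle.
Variable R : realType.

Definition is_integer (x : R) : bool := x \is a Num.int.

Fact is_integer_zmod_closed : zmod_closed (is_integer : {pred R}).
Proof. by split=> [|x y]; [exact: rpred0|exact: rpredB]. Qed.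

HB.instance Definition _ :=
  GRing.isZmodClosed.Build R is_integer is_integer_zmod_closed.

(* The group R / Z. *)
Definition circle : Type :=
  Quotient.quot (GRing.ZmodClosed.clone R is_integer _).

HB.instance Definition _ := GRing.Zmodule.on circle.
HB.instance Definition _ := Quotient.on circle.
HB.instance Definition _ := isPointed.Build circle 0.

Lemma circle_eqE (x y : R) :
  (\pi_circle x == \pi_circle y) = (x - y \is a Num.int).
Proof. by rewrite -(Quotient.idealrBE (GRing.ZmodClosed.clone R is_integer _)). Qed.

Lemma pi_circleB (x y : R) :
  \pi_circle (x - y) = \pi_circle x - \pi_circle y.
Proof. exact: (raddfB \pi_(Quotient.quot (GRing.ZmodClosed.clone R is_integer _))). Qed.

(* This is the topology of [quotient_topology], which cannot be reused directly
   because its choice structure differs from that of the quotient group. *)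
Definition circle_open (U : set circle) : Prop :=
  open (\pi_circle @^-1` U : set R).

Fact circle_openT : circle_open setT.
Proof. exact: openT. Qed.

Fact circle_openI (A B : set circle) :
  circle_open A -> circle_open B -> circle_open (A `&` B).
Proof. exact: openI. Qed.

Fact circle_open_bigcup (I : Type) (f : I -> set circle) :
  (forall i, circle_open (f i)) -> circle_open (\bigcup_i f i).
Proof. by move=> fo; apply: bigcup_open => i _; exact: fo. Qed.

HB.instance Definition _ := isOpenTopological.Build circle
  circle_openT circle_openI circle_open_bigcup.

Definition to_circle (x : measurableTypeR R) : borel circle := \pi_circle x.

Fact measurable_to_circle : measurable_fun setT to_circle.
Proof.
have := @measurability _ _ (measurableTypeR R) (borel circle) setT to_circle (@open circle) erefl; apply => _ [U oU <-].
by rewrite setTI; exact: (@open_measurable R).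
Qed.

HB.instance Definition _ :=
  isMeasurableFun.Build _ _ (measurableTypeR R) (borel circle) to_circle measurable_to_circle.

(* Image under R -> R / Z of Lebesgue measure on [0, 1]. *)
Definition circle_measure : probability (borel circle) R :=
  distribution (uniform_prob (@ltr01 R)) to_circle.

End circle.

Section vdC.
Variable R : realType.
Local Open Scope complex_scope.

Definition circle_integral (f : circle R -> R[i]) : R[i] :=
  (\int[@circle_measure R]_x complex.Re (f x)) +i*
  (\int[@circle_measure R]_x complex.Im (f x)).

(* [R[i]^o] is [R[i]] with the topology of its modulus. *)
Definition ud_mod1 (x : nat -> circle R) : Prop :=
  forall f : circle R -> R[i]^o, continuous f ->
    (N%:R^-1 * \sum_(1 <= n < N.+1) f (x n) : R[i]^o) @[N --> \oo]
      --> (circle_integral f : R[i]^o).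

Definition vdC (H : set nat) : Prop :=
  forall x : nat -> circle R,
    (forall h, H h -> ud_mod1 (fun n => x (n + h)%N - x n)) -> ud_mod1 x.

End vdC.

HB.mixin Record isTopologicalGroup G & Topological G & Group G := {
  mulg_continuous : continuous (fun x : G * G => (x.1 * x.2)%g);
  invg_continuous : continuous (fun x : G => (x^-1)%g) }.

(* Measurable types are pointed, hence [Pointed]. *)
#[short(type="topologicalGroupType")]
HB.structure Definition TopologicalGroup :=
  {G of Pointed G & Topological G & Group G & isTopologicalGroup G}.


Section ud_vdC.
Variables (R : realType) (G : topologicalGroupType).
Local Open Scope ereal_scope.
Implicit Type mu : probability (borel G) R.

(* A Haar measure is translation invariant and regular; for a finite measure,
   regularity amounts to approximation between compact and open sets. *)
Definition is_haar mu : Prop :=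
  (forall (g : G) (A : set (borel G)), measurable A ->
     mu [set (g * a)%g | a in A] = mu A) /\
  (forall (A : set (borel G)) (e : R), measurable A -> (0 < e)%R ->
     exists K U : set G,
       [/\ compact K, open U, K `<=` A, A `<=` U & mu (U `\` K) < e%:E]).

Definition boundary (C : set G) : set G := closure C `\` interior C.

Definition ud mu (x : nat -> G) : Prop :=
  forall C : set G, open C -> mu (boundary C) = 0 ->
    ((count (fun n => x n \in C) (iota 1 N))%:R / N%:R)%:E @[N --> \oo]
      --> mu C.

Definition ud_vdC mu (H : set nat) : Prop :=
  forall x : nat -> G,
    (forall h, H h -> ud mu (fun n => x (n + h)%N * (x n)^-1)%g) -> ud mu x.

End ud_vdC.

Definition Z2 : Type := 'Z_2.
HB.instance Definition _ := Finite.on Z2.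
(* The group law of ['Z_2] as a [groupType] is addition modulo 2, written
   multiplicatively. *)
HB.instance Definition _ := Group.on Z2.

Lemma Z2_mulgE (a b : Z2) : (a * b)%g = (a : 'Z_2) + b :> 'Z_2.
Proof. by []. Qed.

HB.instance Definition _ := isPointed.Build Z2 1%g.
HB.instance Definition _ := hasNbhs.Build Z2 principal_filter.
HB.instance Definition _ := Discrete_ofNbhs.Build Z2 erefl.
HB.instance Definition _ := DiscreteUniform_ofNbhs.Build Z2.

Lemma Z2_mulg_continuous : continuous (fun x : Z2 * Z2 => (x.1 * x.2)%g).
Proof.
move=> [a b] U; rewrite nbhs_principalE => /principal_filterP Uab.
exists ([set a], [set b]) => /=.
  by split; exact: discrete_set1.
by move=> [c d] /= [-> ->].
Qed.

Lemma Z2_invg_continuous : continuous (fun x : Z2 => (x^-1)%g).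
Proof.
move=> a U; rewrite !nbhs_principalE => /principal_filterP Ua.
exact/principal_filterP.
Qed.

HB.instance Definition _ :=
  isTopologicalGroup.Build Z2 Z2_mulg_continuous Z2_invg_continuous.

Lemma Z2_compact : compact [set: Z2].
Proof. by apply: finite_compact; exact: finite_finset. Qed.

Section haar_Z2.
Variable R : realType.

Definition haar_Z2 : set (borel Z2) -> \bar R :=
  mscale (2^-1)%:nng counting.

HB.instance Definition _ := Measure.on haar_Z2.

Lemma haar_Z2E (A : set (borel Z2)) :
  haar_Z2 A = (2^-1 * (#|` fset_set A|)%:R)%:E.
Proof.
rewrite /haar_Z2 /mscale /= /counting asboolT; last exact: finite_finset.
by rewrite -EFinM.
Qed.

Fact haar_Z2_setT : haar_Z2 setT = 1%E.
Proof.
have Z2I2 : ([set: borel Z2] #= `I_2)%card.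
  apply/card_set_bijP; exists (fun i : Z2 => i : nat); split.
  - by move=> i _ /=; exact: ltn_ord.
  - by move=> i j _ _; exact: val_inj.
  - by move=> k /= k2; exists (Ordinal k2).
by rewrite haar_Z2E (card_fset_set Z2I2) mulVf.
Qed.

HB.instance Definition _ :=
  Measure_isProbability.Build _ _ _ haar_Z2 haar_Z2_setT.

Lemma is_haar_haar_Z2 : is_haar haar_Z2.
Proof.
split=> [g A _|A e _ e0].
  rewrite [LHS](haar_Z2E _) [RHS](haar_Z2E _); congr (_ * _%:R)%:E.
  rewrite fset_set_image; last exact: finite_finset.
  by rewrite finmap.card_imfset //; exact: mulgI.
exists A, A; split => //.
- by apply: finite_compact; exact: finite_finset.
- exact: discrete_open.
- by rewrite setDv measure0 lte_fin.
Qed.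

End haar_Z2.

(* Main.v *)
(* The idea.  By Weyl's criterion both notions concern sequences whose
   correlations along H vanish on average while their mean may not.

   vdC => Z_2: given signs y_n with vanishing correlations, take "independent"
   points x_n with law (1 + y_n cos (2 pi x)) dx.  The differences x_{n+h} - x_n
   then have only the averages of y_{n+h} y_n / 4 as nonzero Fourier averages,
   hence are u.d. for h in H, and the first Fourier average of x_n is half the
   mean of y_n.

   Z_2 => vdC: given x_n with u.d. differences, put a_n = cos (2 pi k x_n) and
   b_n = sin (2 pi k x_n), so that a_{n+h} a_n + b_{n+h} b_n has mean 0.  With a
   random sign t that is constant on ever longer blocks, a_n + t_n b_n has
   vanishing correlations and the mean of a_n; "independent" signs with mean
   (a_n + t_n b_n) / 2 reduce this to the Z_2 case.

   Randomness is replaced by a greedy choice: at each step some outcome does not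
   increase the cross term of a weighted sum of squares of all the quantities
   that are to average out, so that each of them grows like a square root. *)
Require Import Defs.
From mathcomp Require Import all_boot all_order all_algebra.
From mathcomp Require Import all_classical all_reals all_analysis.
From mathcomp Require Import complex.
From mathcomp Require Import measurable_realfun ring lra zify.
From Stdlib Require Import PeanoNat.
Set Implicit Arguments.
Unset Strict Implicit.
Unset Printing Implicit Defensive.
Import Order.TTheory GRing.Theory Num.Theory.
Import numFieldNormedType.Exports.
Local Open Scope classical_set_scope.
Local Open Scope ring_scope.

(** * Greedy control of countably many partial sums *)

Section greedy.
Variable R : realType.

Lemma sum_geo_half_le2 (N : nat) : \sum_(j < N) 2^-1 ^+ j <= 2 :> R.
Proof.
suff -> : \sum_(j < N) 2^-1 ^+ j = 2 - 2 * 2^-1 ^+ N :> R.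
  by rewrite gerBl mulr_ge0// exprn_ge0// invr_ge0.
elim: N => [|N IH]; first by rewrite big_ord0 expr0 mulr1 subrr.
by rewrite big_ord_recr/= IH exprS; lra.
Qed.

(* Potential: [\sum_(j < N) c j * S_j(N) ^+ 2], where [S_j(N)] is the sum of the
   [D j] up to [N] and the weights [c j] decay fast enough to let the [j]-th test
   enter at time [j] at a summable cost. *)
Lemma greedy_choice_nat (T : Type) (D : nat -> seq T -> T -> R) (C : nat -> R) :
  (forall n, 0 <= C n) ->
  (forall j s t, `|D j s t| <= C (size s)) ->
  (forall s (r : seq nat) (l : nat -> R),
    exists t, \sum_(j <- r) l j * D j s t <= 0) ->
  exists x : nat -> T, forall j, exists2 A : R, 0 <= A & forall N,
    (\sum_(n < N) D j (mkseq x n) (x n)) ^+ 2 <= A * (1 + \sum_(n < N) C n ^+ 2).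
Proof.
move=> C0 DC ex.
have [t0 _] := ex [::] [::] (fun=> 0).
pose B j : R := \sum_(n < j) C n.
(* [B j.+1] bounds the [j]-th sum at every time up to [j.+1], so dividing by its square caps the
   cost of admitting test [j] at [2^-1 ^+ j]. *)
pose c j : R := 2^-1 ^+ j / (1 + B j.+1 ^+ 2).
have d0 j : 0 < 1 + B j ^+ 2 by rewrite ltr_pwDl// sqr_ge0.
have c0 j : 0 < c j by rewrite divr_gt0// exprn_gt0// invr_gt0.
have cle j : c j <= 2^-1 ^+ j.
  rewrite ler_pdivrMr// ler_peMr ?exprn_ge0 ?invr_ge0//.
  by rewrite lerDl sqr_ge0.
have cB j : c j * B j.+1 ^+ 2 <= 2^-1 ^+ j.
  rewrite /c mulrAC ler_pdivrMr// ler_pM2l ?exprn_gt0 ?invr_gt0//.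
  by rewrite lerDr.
pose S j (s : seq T) := \sum_(n < size s) D j (take n s) (nth t0 s n).
(* The cross term of the potential is linear in the new increments, with coefficients [c j * S j s];
   [f s] is an outcome that makes it nonpositive. *)
have /choice[f fP] s : exists t,
    \sum_(j <- iota 0 (size s)) (c j * S j s) * D j s t <= 0 by exact: ex.
pose s_ n := iter n (fun s => rcons s (f s)) [::].
pose x n := f (s_ n).
have sE n : s_ n = mkseq x n.
  by elim: n => //= n IH; rewrite mkseqS -IH.
pose SN j N := \sum_(n < N) D j (mkseq x n) (x n).
have SE j N : S j (mkseq x N) = SN j N.
  rewrite /S /SN size_mkseq; apply: eq_bigr => n _.
  by rewrite nth_mkseq// /mkseq -map_take take_iota (minn_idPl (ltnW _)).
have step N : \sum_(j < N) (c j * SN j N) * D j (mkseq x N) (x N) <= 0.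
  have := fP (mkseq x N); rewrite size_mkseq -{1}(subn0 N) -/(index_iota 0 N).
  rewrite big_mkord => h; rewrite (le_trans _ h)//.
  rewrite /x sE le_eqVlt; apply/orP; left; apply/eqP.
  by apply: eq_bigr => j _; rewrite SE.
have SB j N : `|SN j N| <= B N.
  rewrite (le_trans (ler_norm_sum _ _ _))//; apply: ler_sum => n _.
  by rewrite (le_trans (DC _ _ _))// size_mkseq.
have Bmono m n : (m <= n)%N -> B m <= B n.
  move=> mn; rewrite /B -!(big_mkord xpredT C) (big_cat_nat (leq0n m) mn)//=.
  by rewrite lerDl sumr_ge0.
have B0 n : 0 <= B n by rewrite sumr_ge0.
have SB2 j N M : (N <= M)%N -> SN j N ^+ 2 <= B M ^+ 2.
  move=> NM; rewrite -real_normK ?num_real// ler_pXn2r ?nnegrE//.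
  exact: le_trans (SB _ _) (Bmono _ _ NM).
(* The potential grows only through admission costs and squared increments; the latter add at most
   [2 * C N ^+ 2], as the weights sum to at most 2. *)
have V N : \sum_(j < N) c j * SN j N ^+ 2 <=
    \sum_(j < N) 2^-1 ^+ j + 2 * \sum_(n < N) C n ^+ 2.
  elim: N => [|N IH]; first by rewrite !big_ord0 mulr0 addr0.
  rewrite big_ord_recr/= [in leRHS]big_ord_recr/= [X in 2 * X]big_ord_recr/=.
  have h1 : c N * SN N N.+1 ^+ 2 <= 2^-1 ^+ N.
    by rewrite (le_trans _ (cB N))// ler_pM2l// SB2.
  have h2 : \sum_(j < N) c j * SN j N.+1 ^+ 2 <=
      \sum_(j < N) c j * SN j N ^+ 2 +
      2 * \sum_(j < N) (c j * SN j N) * D j (mkseq x N) (x N) +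
      (\sum_(j < N) 2^-1 ^+ j) * C N ^+ 2.
    rewrite mulr_sumr mulr_suml -!big_split/=; apply: ler_sum => j _.
    rewrite [SN j N.+1]/SN big_ord_recr/= -/(SN j N).
    set d := D _ _ _; set a := SN j N.
    have : c j * d ^+ 2 <= 2^-1 ^+ j * C N ^+ 2.
      apply: ler_pM => //; [exact: ltW|exact: sqr_ge0|].
      rewrite -real_normK ?num_real// ler_pXn2r ?nnegrE//.
      by rewrite (le_trans (DC _ _ _))// size_mkseq.
    by move: (c j) (2^-1 ^+ j * _) => cj w; lra.
  have h3 : (\sum_(j < N) 2^-1 ^+ j) * C N ^+ 2 <= 2 * C N ^+ 2.
    by rewrite ler_wpM2r ?sqr_ge0// sum_geo_half_le2.
  have := step N; move: h1 h2 h3 IH; rewrite mulrDr; lra.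
exists x => j; exists (2 / c j); first by rewrite divr_ge0// ltW.
move=> N; rewrite -/(SN j N) mulrAC ler_pdivlMr// [leLHS]mulrC.
have C2 : 0 <= \sum_(n < N) C n ^+ 2 by rewrite sumr_ge0// => i _; exact: sqr_ge0.
have [jN|Nj] := ltnP j N.
  have -> : 2 * (1 + \sum_(n < N) C n ^+ 2) = 2 + 2 * \sum_(n < N) C n ^+ 2.
    by rewrite mulrDr mulr1.
  apply: (@le_trans _ _ (\sum_(j < N) c j * SN j N ^+ 2)).
    rewrite (bigD1 (Ordinal jN))//= lerDl sumr_ge0// => i _.
    by rewrite mulr_ge0 ?sqr_ge0// ltW.
  by rewrite (le_trans (V N))// lerD2r sum_geo_half_le2.
have h1 : c j * SN j N ^+ 2 <= 1.
  rewrite (le_trans (_ : _ <= c j * B j.+1 ^+ 2))//.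
    by rewrite ler_pM2l// SB2// ltnW.
  by rewrite (le_trans (cB j))// exprn_ile1// ?invr_ge0// invf_le1// ler1n.
lra.
Qed.

Lemma greedy_choice (T : Type) (I : countType) (D : I -> seq T -> T -> R)
    (C : nat -> R) :
  (forall n, 0 <= C n) ->
  (forall i s t, `|D i s t| <= C (size s)) ->
  (forall s (r : seq I) (l : I -> R),
    exists t, \sum_(i <- r) l i * D i s t <= 0) ->
  exists x : nat -> T, forall i, exists2 A : R, 0 <= A & forall N,
    (\sum_(n < N) D i (mkseq x n) (x n)) ^+ 2 <= A * (1 + \sum_(n < N) C n ^+ 2).
Proof.
move=> C0 DC ex.
(* Tests are numbered through [pickle]; a number that codes no index gets the zero test. *)
pose D' j s t := if @pickle_inv I j is Some i then D i s t else 0.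
have [||x xP] := @greedy_choice_nat T D' C C0.
- by rewrite /D' => j s t; case: pickle_inv => [i|]; rewrite ?normr0.
- move=> s r l.
  have [t ht] := ex s (pmap (@pickle_inv I) r) (l \o pickle).
  exists t; rewrite (le_trans _ ht)// le_eqVlt; apply/orP; left; apply/eqP.
  elim: r {ht} => [|j r IH] /=; first by rewrite !big_nil.
  rewrite big_cons {}IH {1}/D'.
  have := @pickle_invK I j.
  case: pickle_inv => [i|] /=; last by rewrite mulr0 add0r.
  by rewrite big_cons /= => ->.
exists x => i; have [A A0 xA] := xP (pickle i); exists A => // N.
by move: (xA N); rewrite /D' pickleK_inv.
Qed.

End greedy.

(** * Sequences with vanishing averages *)

Section mean0.
Variable R : realType.
Implicit Types (u v : nat -> R) (a : R).

Definition mean0 u : Prop :=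
  (N%:R^-1 * \sum_(1 <= n < N.+1) u n) @[N --> \oo] --> (0 : R).

Lemma mean0P u : mean0 u <->
  forall e : R, 0 < e -> exists N0, forall N, (N0 <= N)%N ->
    `|\sum_(1 <= n < N.+1) u n| <= e * N%:R.
Proof.
split=> [/cvgrPdist_le h e e0|h].
  have [N0 _ N0P] := h _ e0; exists N0 => N NN0.
  have := N0P _ NN0; rewrite /= sub0r normrN normrM normfV normr_nat.
  case: N {NN0} => [|N]; first by rewrite big_geq// normr0 mulr0n !mulr0.
  by move=> h1; rewrite [leRHS]mulrC -ler_pdivrMl ?ltr0n//.
apply/cvgrPdist_le => e e0; have [N0 N0P] := h _ e0.
exists N0 => // N /= NN0; rewrite sub0r normrN normrM normfV normr_nat.
case: N NN0 => [|N] NN0; first by rewrite big_geq// normr0 mulr0 ltW.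
by rewrite ler_pdivrMl ?ltr0n// mulrC N0P.
Qed.

Lemma eq_cvg_seq (f g : nat -> R) a :
  f =1 g -> g @ \oo --> a -> f @ \oo --> a.
Proof. by move/funext->. Qed.

Lemma mean0D u v : mean0 u -> mean0 v -> mean0 (fun n => u n + v n).
Proof.
move=> hu hv; rewrite /mean0 -[X in _ --> X](addr0 (0 : R)).
by apply: eq_cvg_seq (cvgD hu hv) => N /=; rewrite big_split/= mulrDr.
Qed.

Lemma mean0Z a u : mean0 u -> mean0 (fun n => a * u n).
Proof.
move=> hu; rewrite /mean0 -[X in _ --> X](mulr0 a).
by apply: eq_cvg_seq (cvgM (cvg_cst a) hu) => N /=; rewrite -mulr_sumr mulrCA.
Qed.

Lemma mean0_subP u a : mean0 (fun n => u n - a) <->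
  (N%:R^-1 * \sum_(1 <= n < N.+1) u n) @[N --> \oo] --> a.
Proof.
have ca : (N%:R^-1 * \sum_(1 <= n < N.+1) a) @[N --> \oo] --> a.
  apply: cvg_near_cst; exists 1%N => // N /= N1.
  by rewrite sumr_const_nat subSS subn0 -[a *+ _]mulr_natl mulKf// pnatr_eq0 -lt0n.
split=> h.
  rewrite -[X in _ --> X]add0r.
  apply: eq_cvg_seq (cvgD h ca) => N /=.
  by rewrite fctE sumrB mulrBr subrK.
rewrite /mean0 -[X in _ --> X](subrr a).
by apply: eq_cvg_seq (cvgB h ca) => N /=; rewrite fctE sumrB mulrBr.
Qed.

Lemma eq_mean0 u v : (forall n, (0 < n)%N -> u n = v n) -> mean0 u -> mean0 v.
Proof.
move=> uv; apply: eq_cvg_seq => N /=.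
by congr (_ * _); apply: eq_big_nat => n /andP[n0 _]; rewrite uv.
Qed.

Lemma mean0B u v : mean0 u -> mean0 v -> mean0 (fun n => u n - v n).
Proof.
move=> hu hv; apply: eq_mean0 (mean0D hu (mean0Z (-1) hv)) => n _.
by rewrite mulN1r.
Qed.

Lemma le_mean0 u v : (forall n, `|u n| <= v n) -> mean0 v -> mean0 u.
Proof.
move=> uv /mean0P hv; apply/mean0P => e e0; have [N0 N0P] := hv e e0.
exists N0 => N NN0; rewrite (le_trans _ (N0P N NN0))//.
rewrite (le_trans (ler_norm_sum _ _ _))// (le_trans _ (ler_norm _))//.
by rewrite ler_sum.
Qed.

Lemma mean0_le_sum u (b : nat -> R) :
  (forall N, `|\sum_(1 <= n < N.+1) u n| <= b N) ->
  (b N / N%:R) @[N --> \oo] --> (0 : R) -> mean0 u.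
Proof.
move=> ub /cvgrPdist_le hb; apply/mean0P => e e0.
have [N0 _ N0P] := hb e e0; exists N0 => N NN0.
have {N0P} := N0P N NN0; rewrite /= sub0r normrN.
case: N {NN0} => [|N]; first by rewrite big_geq// normr0 mulr0n !mulr0.
move=> h; rewrite (le_trans (ub _))// -ler_pdivrMr ?ltr0n//.
exact: le_trans (ler_norm _) h.
Qed.

Lemma nat_ge_divr a (e : R) : 0 < e ->
  exists N0, forall N, (N0 <= N)%N -> a <= e * N%:R.
Proof.
move=> e0; exists (Num.Def.trunc (a / e)).+1 => N NN0.
rewrite -ler_pdivrMl// mulrC ltW// (lt_le_trans (truncnS_gt _))//.
by rewrite ler_nat.
Qed.

(** Converts square bounds on sums over [n < N], the form given by the greedy choice, into averages
    over [1 <= n <= N]. *)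
Lemma mean0_sqr u (b : nat -> R) :
  (forall N, (\sum_(n < N) u n) ^+ 2 <= b N) ->
  (forall e : R, 0 < e ->
    exists N0, forall N, (N0 <= N)%N -> b N <= e * N%:R ^+ 2) -> mean0 u.
Proof.
move=> ub hb; apply/mean0P => e e0.
(* The slack in [e / 4] pays for [N.+1] terms instead of [N] and for the extra term [u 0]. *)
have e4 : 0 < e / 4 by rewrite divr_gt0.
have [N0 N0P] := hb ((e / 4) ^+ 2) (exprn_gt0 _ e4).
have [N1 N1P] := nat_ge_divr (2 * `|u 0%N|) e0.
exists (maxn 1 (maxn N0 N1)) => N; rewrite !geq_max => /and3P[N_gt0 NN0 NN1].
have N_ge1 : 1 <= N%:R :> R by rewrite ler1n.
have {N1P} h1 := N1P _ NN1.
have h2 : `|\sum_(n < N.+1) u n| <= e / 4 * (N%:R + 1).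
  rewrite natr1 -(@ler_pXn2r _ 2) ?nnegrE ?mulr_ge0 ?(ltW e0) ?(ltW e4)//.
  by rewrite real_normK ?num_real// exprMn (le_trans (ub _))// N0P// leqW.
have -> : \sum_(1 <= n < N.+1) u n = \sum_(n < N.+1) u n - u 0%N.
  by rewrite -(big_mkord xpredT u) [in RHS]big_nat_recl// big_add1/= addrC addKr.
have := ler_normB (\sum_(n < N.+1) u n) (u 0%N).
have : e * 1 <= e * N%:R by rewrite ler_wpM2l// ltW.
by lra.
Qed.

Lemma mean0_sqr_linear u a :
  (forall N, (\sum_(n < N) u n) ^+ 2 <= a * (1 + N%:R)) -> mean0 u.
Proof.
move=> ua; apply: mean0_sqr ua _ => e e0.
have [N0 N0P] := nat_ge_divr (2 * a) e0; exists (maxn 1 N0) => N.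
rewrite geq_max => /andP[N_gt0 /N0P h].
have N1 : 1 <= N%:R :> R by rewrite ler1n.
have [a0|a0] := leP 0 a.
  have : a <= a * N%:R by rewrite ler_peMr.
  have : 2 * a * N%:R <= e * N%:R * N%:R by rewrite ler_wpM2r.
  by rewrite expr2 mulrA; lra.
rewrite (@le_trans _ _ 0)//; last by rewrite mulr_ge0 ?sqr_ge0// ltW.
by rewrite mulr_le0_ge0 ?addr_ge0// ltW.
Qed.

Lemma cvg_cst_div_nat a : (a / N%:R) @[N --> \oo] --> (0 : R).
Proof.
rewrite -(mulr0 a); apply: cvgMl_tmp.
apply/(@gtr0_cvgV0 R) => //; last exact: cvgr_idn.
by exists 1%N => // n /= n1; rewrite ltr0n.
Qed.

(** Shifting changes a partial sum only by [h] terms at each end, each at most [a]. *)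
Lemma mean0_shift u a h : (forall n, `|u n| <= a) ->
  mean0 u -> mean0 (fun n => u (n + h)%N).
Proof.
move=> ua hu.
suff : mean0 (fun n => u (n + h)%N - u n).
  by move/(mean0D hu); apply: eq_mean0 => n _; rewrite addrC subrK.
apply: (@mean0_le_sum _ (fun=> h%:R * a + h%:R * a)); last exact: cvg_cst_div_nat.
move=> N; rewrite sumrB.
have -> : \sum_(1 <= n < N.+1) u (n + h)%N = \sum_(1 + h <= i < N.+1 + h) u i.
  by rewrite big_addn addnK.
have -> : \sum_(1 + h <= i < N.+1 + h) u i - \sum_(1 <= i < N.+1) u i =
    \sum_(N.+1 <= i < N.+1 + h) u i - \sum_(1 <= i < 1 + h) u i.
  have e1 := @big_cat_nat _ _ _ (1 + h) 1 (N.+1 + h) xpredT u (leq_addr _ _) _.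
  have e2 := @big_cat_nat _ _ _ N.+1 1 (N.+1 + h) xpredT u (ltn0Sn _) (leq_addr _ _).
  rewrite -(addrK (\sum_(1 <= i < 1 + h) u i) (\sum_(1 + h <= i < N.+1 + h) u i)).
  by rewrite [X in X - _ - _]addrC -e1 ?leq_add2r// e2 /=; ring.
have sumle m : `|\sum_(m <= i < m + h) u i| <= h%:R * a.
  rewrite (le_trans (ler_norm_sum _ _ _))// (le_trans (ler_sum _ (fun i _ => ua i)))//.
  by rewrite sumr_const_nat addKn mulr_natl.
by rewrite (le_trans (ler_normB _ _))// lerD.
Qed.

End mean0.

(** * Equidistribution in the two-element group *)

Section Z2.
Variable R : realType.

Definition Z2sign (z : Z2) : R := (-1) ^+ (z : nat).

Lemma Z2_cases (z : Z2) : z = ord0 \/ z = ord_max.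
Proof. by case: z => [[|[|k]] hk] //; [left|right]; exact: val_inj. Qed.

Lemma Z2sign_sqr z : Z2sign z * Z2sign z = 1.
Proof. by rewrite /Z2sign -expr2 sqrr_sign. Qed.

Lemma Z2sign_norm z : `|Z2sign z| = 1.
Proof. by rewrite normr_sign. Qed.

Lemma Z2signMV a b : Z2sign (a * b^-1)%g = Z2sign a * Z2sign b.
Proof.
rewrite /Z2sign -exprD; have [->|->] := Z2_cases a; have [->|->] := Z2_cases b;
  by rewrite ?sqrrN ?expr0 ?expr1 ?expr1n.
Qed.

Lemma Z2_boundary0 (C : set Z2) : boundary C = set0.
Proof.
rewrite /boundary; have -> : closure C = C.
  by symmetry; apply/closure_id; exact: discrete_closed.
by rewrite (interior_id C).1 ?setDv//; exact: discrete_open.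
Qed.

Lemma haar_Z2_sum (C : set Z2) : haar_Z2 R C =
  (2^-1 * ((ord0 \in C)%:R + (ord_max \in C)%:R))%:E.
Proof.
have one z : haar_Z2 R [set z] = (2^-1)%:E.
  by rewrite haar_Z2E fset_set1 finmap.cardfs1 mulr1.
have [h0|h0] := boolP (_ \in C); have [h1|h1] := boolP (_ \in C).
- rewrite (_ : C = setT) ?haar_Z2_setT ?mulVf//.
  by apply/seteqP; split => // z _; have [->|->] := Z2_cases z; exact: set_mem.
- rewrite (_ : C = [set ord0]) ?one ?addr0 ?mulr1//.
  apply/seteqP; split => [z|z ->]; last exact: set_mem.
  by have [->|->] := Z2_cases z => // /mem_set; rewrite (negbTE h1).
- rewrite (_ : C = [set ord_max]) ?one ?add0r ?mulr1//.
  apply/seteqP; split => [z|z ->]; last exact: set_mem.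
  by have [->|->] := Z2_cases z => // /mem_set; rewrite (negbTE h0).
- rewrite (_ : C = set0) ?measure0 ?addr0 ?mulr0//.
  apply/seteqP; split => [z|z //].
  by have [->|->] := Z2_cases z => // /mem_set;
    rewrite ?(negbTE h0) ?(negbTE h1).
Qed.

(** Weyl's criterion for this group: the sign is its only nontrivial character, and every indicator
    is an affine function of it. All boundaries are empty, so every set is a test set. *)
Lemma ud_Z2P (x : nat -> Z2) :
  ud (haar_Z2 R) x <-> mean0 (fun n => Z2sign (x n)).
Proof.
have cnt (C : set Z2) N : (count (fun n => x n \in C) (iota 1 N))%:R =
    \sum_(1 <= n < N.+1) (x n \in C)%:R :> R.
  rewrite -sum1_count natr_sum /index_iota subSS subn0 big_mkcond/=.
  by apply: eq_bigr => n _; case: (_ \in _).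
split=> [h|h C _ _].
  have := h [set ord0] (discrete_open _).
  rewrite Z2_boundary0 measure0 [X in _ --> X](haar_Z2_sum [set ord0]) => /(_ erefl) /fine_cvg /= {}h.
  have : mean0 (fun n => (x n \in [set ord0 : Z2])%:R - 2^-1 : R).
    apply/mean0_subP; have e0 : (ord0 : Z2) \in [set ord0 : Z2] by exact: mem_set.
    have e1 : (ord_max : Z2) \in [set ord0 : Z2] = false.
      by apply/negbTE/negP => /set_mem.
    rewrite e0 e1 addr0 mulr1 in h.
    by apply: eq_cvg_seq h => N; rewrite mulrC -cnt.
  move/(mean0Z 2); apply: eq_mean0 => n _.
  have [->|->] := Z2_cases (x n).
    by rewrite mem_set//= /Z2sign expr0; lra.
  by rewrite memNset//= /Z2sign expr1; lra.
rewrite [X in _ --> X](haar_Z2_sum C); set i0 := (ord0 \in C)%:R; set i1 := (ord_max \in C)%:R.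
have : mean0 (fun n => (x n \in C)%:R - 2^-1 * (i0 + i1)).
  apply: eq_mean0 (mean0Z (2^-1 * (i0 - i1)) h) => n _.
  have [->|->] := Z2_cases (x n); rewrite -/i0 -/i1 /Z2sign ?expr0 ?expr1; lra.
move/mean0_subP => hC; apply: cvg_EFin; first exact: nearW.
by apply: eq_cvg_seq hC => N /=; rewrite cnt mulrC.
Qed.

End Z2.

(** * From signs to bounded and then planar sequences *)

Section signs.
Variable R : realType.

Lemma greedy_mean0 (T : Type) (I : countType) (D : I -> seq T -> T -> R) (c : R) :
  0 <= c ->
  (forall i s t, `|D i s t| <= c) ->
  (forall s (r : seq I) (l : I -> R),
    exists t, \sum_(i <- r) l i * D i s t <= 0) ->
  exists x : nat -> T, forall i, mean0 (fun n => D i (mkseq x n) (x n)).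
Proof.
move=> c0 Dc ex.
have [//|x xP] := greedy_choice (C := fun=> c) (fun=> c0) _ ex.
exists x => i; have [A A0 {}xP] := xP i.
apply: (@mean0_sqr_linear _ _ (A * (1 + c ^+ 2))) => N.
rewrite (le_trans (xP N))// -mulrA ler_wpM2l// sumr_const card_ord -mulr_natl.
have : 0 <= N%:R :> R by [].
have := sqr_ge0 c; lra.
Qed.

(** A random sign of mean [w] gives expectation 0; concretely, the sign opposite to that of [G]
    works. *)
Lemma sign_choice (w : R) (G : R) : `|w| <= 1 ->
  exists z : Z2, (Z2sign R z - w) * G <= 0.
Proof.
rewrite ler_norml => /andP[w1 w2]; have [G0|G0] := leP 0 G.
  exists ord_max; rewrite mulr_le0_ge0//.
  rewrite /Z2sign expr1; lra.
exists ord0; rewrite mulr_ge0_le0 ?(ltW G0)//.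
rewrite /Z2sign expr0; lra.
Qed.

(** Greedy signs [y] imitate independent signs of mean [w]: they have the averages of [w] and, along
    [H], its correlations. *)
Lemma ud_vdC_Z2_bounded (H : set nat) (w : nat -> R) :
  (forall h, H h -> (0 < h)%N) -> ud_vdC (haar_Z2 R) H ->
  (forall n, `|w n| <= 1) ->
  (forall h, H h -> mean0 (fun n => w (n + h)%N * w n)) -> mean0 w.
Proof.
move=> H0 Hvdc w1 hw.
(* The deviation [y - w] is tested against 1, against the sign chosen [h] steps earlier, and against
   [w] at [h] steps later. *)
pose g (i : option (nat * bool)) (s : seq Z2) : R :=
  match i with
  | None => 1
  | Some (h, true) => Z2sign R (nth ord0 s (size s - h))
  | Some (h, false) => w (size s + h)%N
  end.
have g1 i s : `|g i s| <= 1.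
  by case: i => [[h []]|] /=; rewrite ?normr1 ?Z2sign_norm.
pose D i s t := (Z2sign R t - w (size s)) * g i s.
have D2 i s t : `|D i s t| <= 2.
  rewrite normrM -[leRHS]mulr1 ler_pM//.
  rewrite (le_trans (ler_normB _ _))// Z2sign_norm.
  by have := w1 (size s); lra.
have [//|s r l|x xP] := greedy_mean0 _ D2.
  have [z hz] := sign_choice (\sum_(i <- r) l i * g i s) (w1 (size s)).
  exists z; rewrite (le_trans _ hz)// mulr_sumr.
  by under eq_bigr do rewrite mulrCA.
pose y n := Z2sign R (x n).
have yw : mean0 (fun n => y n - w n).
  by apply: eq_mean0 (xP None) => n _; rewrite /D /g size_mkseq mulr1.
suff : mean0 y.
  by move/mean0B => /(_ _ yw); apply: eq_mean0 => n _; rewrite subKr.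
apply/ud_Z2P; apply: Hvdc => h Hh; apply/ud_Z2P.
(* The backward test is read at time [n + h]; positivity of [h] ensures that [y n] was already
   chosen then. *)
have h1 : mean0 (fun n => (y (n + h)%N - w (n + h)%N) * y n).
  have := mean0_shift h (fun n => D2 _ _ _) (xP (Some (h, true))).
  apply: eq_mean0 => n _; rewrite /D /= size_mkseq addnK nth_mkseq//.
  by rewrite -[X in (X < _)%N]addn0 ltn_add2l H0.
have h2 : mean0 (fun n => (y n - w n) * w (n + h)%N).
  by apply: eq_mean0 (xP (Some (h, false))) => n _; rewrite /D /= size_mkseq.
apply: eq_mean0 (mean0D (mean0D h1 h2) (hw h Hh)) => n _.
by rewrite Z2signMV -/(y _) -/(y n); ring.
Qed.

Lemma sqrt_bounds n :
  (Nat.sqrt n * Nat.sqrt n <= n < (Nat.sqrt n).+1 * (Nat.sqrt n).+1)%N.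
Proof. by have := Nat.sqrt_spec' n; lia. Qed.

Lemma sum_square_blocks (f : nat -> R) K :
  \sum_(n < K * K) f n = \sum_(k < K) \sum_(k * k <= n < k.+1 * k.+1) f n.
Proof.
elim: K => [|K IH]; first by rewrite !big_ord0.
rewrite [RHS]big_ord_recr/= -IH -!(big_mkord xpredT f).
by apply: big_cat_nat => //; lia.
Qed.

(* The blocks are [k^2 <= n < (k+1)^2]: long enough for [t] to be almost
   shift-invariant, short enough for the random signs to average out. *)
Lemma block_signs (I : countType) (q : I -> nat -> R) (c : R) :
  (forall i n, `|q i n| <= c) ->
  exists t : nat -> Z2, forall i, mean0 (fun n => Z2sign R (t (Nat.sqrt n)) * q i n).
Proof.
move=> qc.
pose Q i k := \sum_(k * k <= n < k.+1 * k.+1) q i n.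
have sumc i m n p : (n - m <= p)%N -> `|\sum_(m <= j < n) q i j| <= `|c| * p%:R.
  move=> mn; rewrite (le_trans (ler_norm_sum _ _ _))//.
  apply: (@le_trans _ _ (\sum_(m <= j < n) `|c|)).
    by apply: ler_sum => j _; rewrite (le_trans (qc _ _))// ler_norm.
  by rewrite sumr_const_nat -[_ *+ (n - m)]mulr_natr ler_wpM2l// ler_nat.
have Qc i k : `|Q i k| <= `|c| * (2 * k + 1)%:R by apply: sumc; lia.
(* One greedy step per block: the increment is a whole block sum, of size linear in the block
   number. *)
pose D i (s : seq Z2) z := Z2sign R z * Q i (size s).
have [||s r l|t tP] := @greedy_choice R Z2 I D (fun k => `|c| * (2 * k + 1)%:R).
- by move=> k; rewrite mulr_ge0.
- by move=> i s z; rewrite /D normrM Z2sign_norm mul1r.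
- have [|z hz] := @sign_choice 0 (\sum_(i <- r) l i * Q i (size s)).
    by rewrite normr0.
  exists z; rewrite (le_trans _ hz)// subr0 mulr_sumr.
  by under eq_bigr do rewrite mulrCA.
exists t => i; have [A A0 {}tP] := tP i.
(* Complete blocks plus the trailing partial block, combined by [(S + T)^2 <= 2 S^2 + 2 T^2]; the
   order is [N^(3/2)]. *)
pose b N := 2 * (A * (1 + (Nat.sqrt N)%:R * (`|c| * (2 * Nat.sqrt N + 1)%:R) ^+ 2)) +
            2 * (`|c| * (2 * Nat.sqrt N + 1)%:R) ^+ 2.
apply: (@mean0_sqr _ _ b) => [N|e e0].
  have /andP[KN NK] := sqrt_bounds N.
  have -> : \sum_(n < N) Z2sign R (t (Nat.sqrt n)) * q i n =
      \sum_(n < Nat.sqrt N) D i (mkseq t n) (t n) +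
      Z2sign R (t (Nat.sqrt N)) * \sum_(Nat.sqrt N * Nat.sqrt N <= n < N) q i n.
    rewrite -(big_mkord xpredT (fun n => Z2sign R (t (Nat.sqrt n)) * q i n)).
    rewrite (big_cat_nat (leq0n _) KN)/= big_mkord.
    rewrite (sum_square_blocks (fun n => Z2sign R (t (Nat.sqrt n)) * q i n)).
    congr (_ + _).
      apply: eq_bigr => k _; rewrite /D size_mkseq mulr_sumr.
      apply: eq_big_nat => n hn; rewrite (Nat.sqrt_unique n k)//; lia.
    rewrite mulr_sumr; apply: eq_big_nat => n hn.
    by rewrite (Nat.sqrt_unique n (Nat.sqrt N))//; lia.
  set S := \sum_(n < _) _; set z := Z2sign R _; set T := \sum_(_ <= n < _) _.
  have hS : S ^+ 2 <= A * (1 + (Nat.sqrt N)%:R * (`|c| * (2 * Nat.sqrt N + 1)%:R) ^+ 2).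
    rewrite (le_trans (tP (Nat.sqrt N)))// ler_wpM2l// lerD2l.
    rewrite mulr_natl -[X in _ *+ X]card_ord -sumr_const ler_sum// => k _.
    rewrite ler_pXn2r ?nnegrE ?mulr_ge0// ler_wpM2l// ler_nat.
    by have := ltn_ord k; lia.
  have hT : (z * T) ^+ 2 <= (`|c| * (2 * Nat.sqrt N + 1)%:R) ^+ 2.
    rewrite -real_normK ?num_real// ler_pXn2r ?nnegrE ?mulr_ge0//.
    by rewrite normrM Z2sign_norm mul1r; apply: sumc; lia.
  have := sqr_ge0 (S - z * T); rewrite /b; lra.
(* From [(2 k + 1)^2 <= 9 k^2] one gets [b N <= M k^3] with [k = Nat.sqrt N]; then [M <= e k] and
   [k^4 <= N^2] finish. *)
pose M := 2 * A + 18 * `|c| ^+ 2 * (A + 1).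
have [k0 k0P] := nat_ge_divr M e0.
exists (k0.+1 * k0.+1)%N => N hN.
have /andP[KN NK] := sqrt_bounds N.
have k0K : (k0 < Nat.sqrt N)%N.
  by rewrite ltnNge; apply/negP => hK; nia.
have {k0P} hM := k0P _ (ltnW k0K).
have K1 : 1 <= (Nat.sqrt N)%:R :> R by rewrite ler1n; lia.
have KNR : (Nat.sqrt N)%:R ^+ 2 <= N%:R :> R by rewrite -natrX ler_nat expnS expn1.
rewrite /b natrD natrM; move: (Nat.sqrt N)%:R K1 KNR hM => k k1 kN hM.
have k3 : 1 <= k ^+ 3 by rewrite exprn_ege1.
have hk : k ^+ 2 <= k ^+ 3 by rewrite [leRHS]exprS ler_peMl ?sqr_ge0.
apply: (@le_trans _ _ (M * k ^+ 3)).
  have h9 : (`|c| * (2 * k + 1)) ^+ 2 <= 9 * `|c| ^+ 2 * k ^+ 2.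
    rewrite exprMn (_ : 9 * `|c| ^+ 2 * k ^+ 2 = `|c| ^+ 2 * (9 * k ^+ 2)).
      by rewrite ler_wpM2l ?sqr_ge0//; nra.
    by ring.
  have c2 := sqr_ge0 `|c|.
  rewrite /M; move: h9; set X := (_ * _) ^+ 2; move: (`|c| ^+ 2) c2 @X => C C0 X hX.
  have h1 : A <= A * k ^+ 3 by rewrite ler_peMr.
  have h2 : A * k * X <= A * C * 9 * k ^+ 3.
    rewrite [leRHS](_ : _ = A * k * (9 * C * k ^+ 2)); last by ring.
    by rewrite ler_wpM2l// mulr_ge0// (le_trans _ k1).
  have h3 : C * k ^+ 2 <= C * k ^+ 3 by rewrite ler_wpM2l.
  move: hX h1 h2 h3; rewrite -!mulrA; lra.
have k_ge0 : 0 <= k by rewrite (le_trans _ k1).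
apply: (@le_trans _ _ (e * k * k ^+ 3)); first by rewrite ler_wpM2r// exprn_ge0.
rewrite -mulrA -exprS ler_wpM2l ?(ltW e0)// (exprM k 2 2) ler_pXn2r ?nnegrE//.
exact: exprn_ge0.
Qed.

(** The sum telescopes to [Nat.sqrt N], whose square is at most [N]. *)
Lemma mean0_sqrt_step : mean0 (fun n => (Nat.sqrt n.+1)%:R - (Nat.sqrt n)%:R : R).
Proof.
apply: (@mean0_sqr_linear _ _ 1) => N; rewrite mul1r.
rewrite -(big_mkord xpredT (fun n => (Nat.sqrt n.+1)%:R - (Nat.sqrt n)%:R)).
rewrite (telescope_sumr (fun n => (Nat.sqrt n)%:R))// subr0 -natrX.
rewrite -[1]/(1%:R) -natrD ler_nat.
by have /andP[h _] := sqrt_bounds N; lia.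
Qed.

(** The difference is at least 1 whenever [n] and [n + h] lie in different blocks, so such [n] have
    density 0. *)
Lemma mean0_sqrt_shift h :
  mean0 (fun n => (Nat.sqrt (n + h))%:R - (Nat.sqrt n)%:R : R).
Proof.
elim: h => [|h IH].
  apply: eq_mean0 (mean0Z 0 mean0_sqrt_step) => n _.
  by rewrite mul0r addn0 subrr.
have step1 n : `|(Nat.sqrt n.+1)%:R - (Nat.sqrt n)%:R : R| <= 1.
  have := Nat.sqrt_succ_le n; have := @Nat.sqrt_le_mono n n.+1.
  move: (Nat.sqrt n.+1) (Nat.sqrt n) => a b h1 h2.
  rewrite -natrB; last by lia.
  by rewrite normr_nat lern1; lia.
apply: eq_mean0 (mean0D IH (mean0_shift h step1 mean0_sqrt_step)) => n _.
by rewrite addnS [LHS]addrC addrA subrK.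
Qed.

(** For a locally constant sign [t], the product of two values of [a + t b] is the planar
    correlation plus [t] times a mixed term, and block signs average the mixed term out. *)
Lemma ud_vdC_Z2_planar (H : set nat) (a b : nat -> R) :
  (forall h, H h -> (0 < h)%N) -> ud_vdC (haar_Z2 R) H ->
  (forall n, `|a n| <= 1) -> (forall n, `|b n| <= 1) ->
  (forall h, H h -> mean0 (fun n => a (n + h)%N * a n + b (n + h)%N * b n)) ->
  mean0 a.
Proof.
move=> H0 Hvdc a1 b1 hab.
(* What gets multiplied by [t]: the mixed terms of the correlations, and [b] itself, so that
   [a + t b] keeps the mean of [a]. *)
pose q (i : option nat) n :=
  if i is Some h then a (n + h)%N * b n + b (n + h)%N * a n else b n.
have M1 (x y : R) : `|x| <= 1 -> `|y| <= 1 -> `|x * y| <= 1.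
  by move=> x1 y1; rewrite normrM mulr_ile1.
have q2 i n : `|q i n| <= 2.
  case: i => [h|] /=; last by have := b1 n; lra.
  by rewrite (le_trans (ler_normD _ _))// -[2]/(1 + 1) lerD// M1.
have [z zP] := block_signs q2.
pose t n := Z2sign R (z (Nat.sqrt n)).
pose w n := 2^-1 * (a n + t n * b n).
have t1 n : `|t n| = 1 by rewrite Z2sign_norm.
have tt n : t n * t n = 1 by exact: Z2sign_sqr.
suff hw : mean0 w.
  apply: eq_mean0 (mean0B (mean0Z 2 hw) (zP None)) => n _.
  by rewrite /w mulrA mulfV// mul1r addrK.
apply: (ud_vdC_Z2_bounded H0 Hvdc) => [n|h Hh].
  rewrite /w normrM gtr0_norm ?invr_gt0//.
  have := ler_normD (a n) (t n * b n); rewrite normrM t1 mul1r.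
  by have := a1 n; have := b1 n; lra.
have main := mean0Z 4^-1 (mean0D (hab h Hh) (zP (Some h))).
apply: eq_mean0 (mean0D main _) => [n _|]; last first.
  apply: (le_mean0 _ (mean0_sqrt_shift h)).
  (* The error of replacing [t (n + h)] by [t n]: it is at most 1 and vanishes unless a block
     boundary is crossed. *)
  instantiate (1 := fun n => 4^-1 * ((t (n + h)%N - t n) * (b (n + h)%N * (a n + t n * b n)))).
  move=> n /=.
  have smono := @Nat.sqrt_le_mono n (n + h)%N.
  have [st|st] := eqVneq (Nat.sqrt (n + h)%N) (Nat.sqrt n).
    by rewrite /t st !subrr mul0r mulr0 normr0.
  have st1 : 1 <= (Nat.sqrt (n + h))%:R - (Nat.sqrt n)%:R :> R.
    by rewrite -natrB ?ler1n; lia.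
  rewrite (le_trans _ st1)// !normrM gtr0_norm ?invr_gt0//.
  have tt2 : `|t (n + h)%N - t n| <= 2.
    by rewrite (le_trans (ler_normB _ _))// !t1; lra.
  have ab2 : `|b (n + h)%N| * `|a n + t n * b n| <= 2.
    rewrite -[leRHS]mul1r ler_pM// (le_trans (ler_normD _ _))// normrM t1 mul1r.
    by have := a1 n; have := b1 n; lra.
  by rewrite ler_pdivrMl// mulr1 (_ : 4 = 2 * 2) ?ler_pM ?mulr_ge0//; ring.
rewrite /= -/(t n) /w; have := tt n; set s := t n; set s' := t _ => ss.
apply/eqP; rewrite -subr_eq0.
rewrite (_ : _ - _ = 4^-1 * (1 - s * s) * (b (n + h)%N * b n)); last by field.
by rewrite ss subrr mulr0 mul0r.
Qed.

End signs.

(** * Trigonometric sums and the Fejer kernel *)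

Section trig.
Variable R : realType.
Implicit Types (x phi theta : R).

Lemma cosD2pi_int (m : int) phi : cos (phi + 2 * pi * m%:~R) = cos phi.
Proof.
have nat_case (n : nat) (a : R) : cos (a + 2 * pi * n%:R) = cos a.
  by rewrite -(periodicn (@cosD2pi R) n a); congr (cos (_ + _)); ring.
case: m => n; first exact: nat_case.
rewrite NegzE mulrNz mulrN -[RHS](nat_case n.+1) -[LHS](nat_case n.+1).
by rewrite -pmulrn subrK nat_case.
Qed.

Lemma sinE_cos theta : sin theta = cos (theta - pi / 2).
Proof. by rewrite cosBpihalf. Qed.

(* [|1 + q + ... + q^(n-1)|^2 |1 - q|^2 = |1 - q^n|^2] for [q = exp (i theta)]. *)
Lemma dirichlet_sum n theta :
  ((\sum_(k < n) cos (k%:R * theta)) ^+ 2 +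
   (\sum_(k < n) sin (k%:R * theta)) ^+ 2) * (1 - cos theta) =
  1 - cos (n%:R * theta).
Proof.
set C := \sum_(k < n) _; set S := \sum_(k < n) _.
have tele (f : R -> R) : \sum_(k < n) (f (k%:R * theta + theta) - f (k%:R * theta))
    = f (n%:R * theta) - f 0.
  rewrite -(big_mkord xpredT (fun k => f (k%:R * theta + theta) - f (k%:R * theta))).
  transitivity (\sum_(0 <= k < n) (f (k.+1%:R * theta) - f (k%:R * theta))).
    by apply: eq_bigr => k _; rewrite -natr1 mulrDl mul1r.
  by rewrite (telescope_sumr (fun k => f (k%:R * theta)))// mul0r.
have h1 : C * (1 - cos theta) + S * sin theta = 1 - cos (n%:R * theta).
  apply: oppr_inj; rewrite opprB -[X in _ = _ - X](@cos0 R) -(tele cos).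
  rewrite mulrBr mulr1 !mulr_suml -sumrB -big_split -sumrN /=.
  by apply: eq_bigr => k _; rewrite cosD; ring.
have h2 : C * sin theta - S * (1 - cos theta) = sin (n%:R * theta).
  transitivity (sin (n%:R * theta) - sin 0); last by rewrite sin0 subr0.
  rewrite -(tele sin).
  rewrite mulrBr mulr1 !mulr_suml -!sumrB /=.
  by apply: eq_bigr => k _; rewrite sinD; ring.
have c1 := cos2Dsin2 theta; have cn := cos2Dsin2 (n%:R * theta).
have : (C * (1 - cos theta) + S * sin theta) ^+ 2 +
       (C * sin theta - S * (1 - cos theta)) ^+ 2 = 2 * (1 - cos (n%:R * theta)).
  by rewrite h1 h2; lra.
rewrite (_ : _ + _ = (C ^+ 2 + S ^+ 2) * (1 - 2 * cos theta + (cos theta ^+ 2 + sin theta ^+ 2))).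
  by rewrite c1; lra.
by ring.
Qed.

Lemma cos2pi_lt1 x : 0 < x < 1 -> cos (2 * pi * x) < 1.
Proof.
move=> /andP[x0 x1].
have a0 : 0 < sin (pi * x).
  by apply: sin_gt0_pi; rewrite mulr_gt0 ?pi_gt0//= gtr_pMr ?pi_gt0.
rewrite (_ : _ * _ = (pi * x) *+ 2) ?cos_mulr2n; last by ring.
by have := cos2Dsin2 (pi * x); have := exprn_gt0 2 a0; lra.
Qed.

(** In [dirichlet_sum] with angle [2 pi k / M] the right side vanishes while [1 - cos theta] does
    not, so both the cosine and the sine sums are 0. *)
Lemma sum_cos_grid (k M : nat) phi : (0 < k < M)%N ->
  \sum_(i < M) cos (phi + 2 * pi * (k%:R * (i%:R / M%:R))) = 0.
Proof.
move=> kM; have M0 : M%:R != 0 :> R by rewrite pnatr_eq0; lia.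
have kM1 : 0 < (k%:R / M%:R : R) < 1.
  by rewrite divr_gt0 ?ltr_pdivrMr ?mul1r ?ltr_nat ?ltr0n; lia.
pose theta : R := 2 * pi * (k%:R / M%:R).
have := dirichlet_sum M theta.
rewrite (_ : M%:R * theta = 0 + 2 * pi * (k : int)%:~R); last first.
  by rewrite /theta -pmulrn; field.
rewrite cosD2pi_int cos0 subrr => /eqP.
rewrite mulf_eq0 subr_eq0 [1 == _]eq_sym (lt_eqF (cos2pi_lt1 kM1)) orbF.
rewrite paddr_eq0 ?sqr_ge0// !sqrf_eq0 => /andP[/eqP C0 /eqP S0].
rewrite (eq_bigr (fun i : 'I_M => cos phi * cos (i%:R * theta) -
    sin phi * sin (i%:R * theta))).
  by rewrite sumrB -!mulr_sumr C0 S0 !mulr0 subrr.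
by move=> i _; rewrite -cosD; congr (cos (_ + _)); rewrite /theta; field.
Qed.

(** The Fejer kernel, written as a squared modulus so that nonnegativity is immediate. *)
Definition fejer n theta : R := n%:R^-1 *
  ((\sum_(k < n) cos (k%:R * theta)) ^+ 2 + (\sum_(k < n) sin (k%:R * theta)) ^+ 2).

Lemma fejer_ge0 n theta : 0 <= fejer n theta.
Proof. by rewrite mulr_ge0 ?invr_ge0// addr_ge0 ?sqr_ge0. Qed.

Lemma fejer_le n theta : fejer n theta * (1 - cos theta) <= 2 / n%:R.
Proof.
rewrite /fejer -mulrA dirichlet_sum mulrC ler_wpM2r ?invr_ge0//.
by have := cos_geN1 (n%:R * theta); lra.
Qed.

Lemma fejerE n theta : fejer n theta =
  n%:R^-1 * \sum_(k < n) \sum_(l < n) cos ((k%:R - l%:R) * theta).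
Proof.
rewrite /fejer !expr2 !mulr_suml -big_split; congr (_ * _).
apply: eq_bigr => k _ /=; rewrite !mulr_sumr -big_split.
by apply: eq_bigr => l _ /=; rewrite mulrBl cosB.
Qed.

Lemma sum_cosB_grid (k l M : nat) x : (k < M)%N -> (l < M)%N ->
  \sum_(i < M) cos ((k%:R - l%:R) * (2 * pi * (x - i%:R / M%:R))) =
  M%:R * (k == l)%:R.
Proof.
move=> kM lM; have [->|kl] := eqVneq k l.
  under eq_bigr do rewrite subrr mul0r cos0.
  by rewrite sumr_const card_ord mulr1.
rewrite mulr0; wlog lk : k l kM lM kl / (l < k)%N => [hw|].
  have [/(hw k l)->//|kl'|kl'] := ltngtP l k; last by rewrite kl' eqxx in kl.
  rewrite -[RHS](hw l k)// 1?eq_sym//; apply: eq_bigr => i _.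
  by rewrite -cosN; congr cos; ring.
rewrite -[RHS](@sum_cos_grid (k - l) M (- ((k%:R - l%:R) * (2 * pi * x)))); last by lia.
apply: eq_bigr => i _; rewrite -cosN natrB ?(ltnW lk)//; congr cos; ring.
Qed.

(** All frequencies [k - l] are below [M] in modulus, so the grid kills every one except the [n]
    diagonal terms. *)
Lemma mean_fejer_grid n M x : (0 < n)%N -> (n <= M)%N ->
  M%:R^-1 * \sum_(i < M) fejer n (2 * pi * (x - i%:R / M%:R)) = 1.
Proof.
move=> n0 nM; have M0 : M%:R != 0 :> R by rewrite pnatr_eq0; lia.
have nR0 : n%:R != 0 :> R by rewrite pnatr_eq0; lia.
under eq_bigr do rewrite fejerE.
rewrite -mulr_sumr exchange_big/=.
under eq_bigr => k _.
  rewrite exchange_big/=.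
  under eq_bigr => l _ do rewrite sum_cosB_grid ?(leq_trans (ltn_ord _) nM)//.
  rewrite -mulr_sumr (bigD1 k)//= eqxx big1 ?addr0 ?mulr1; last first.
    by move=> l; rewrite eq_sym -val_eqE => /negbTE ->.
  over.
rewrite sumr_const card_ord -mulr_natl; field.
by rewrite nR0 M0.
Qed.

End trig.

(** * Continuous functions on the circle and their integrals *)

Section circle_functions.
Variable R : realType.
Implicit Types (f : circle R -> R) (x y s : R).

Local Notation pi_ := (\pi_(circle R)%qT : R -> circle R).

Lemma continuous_pi_circle : continuous pi_.
Proof. by apply/continuousP => U oU. Qed.

Lemma circle_continuous f : continuous (f \o pi_) -> continuous f.
Proof. by move=> /continuousP cf; apply/continuousP => U oU; exact: cf. Qed.

Lemma circle_continuousD f g :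
  continuous f -> continuous g -> continuous (fun z => f z + g z).
Proof.
move=> cf cg; apply: circle_continuous => x.
have cpi (h : circle R -> R) : continuous h -> {for x, continuous (h \o pi_)}.
  by move=> ch; apply: continuous_comp; [exact: continuous_pi_circle|exact: ch].
by apply: cvgD; exact: cpi.
Qed.

Lemma circle_continuousZ a f : continuous f -> continuous (fun z => a * f z).
Proof.
move=> cf; apply: circle_continuous => x.
apply: cvgM; first exact: cvg_cst.
by apply: continuous_comp; [exact: continuous_pi_circle|exact: cf].
Qed.

Lemma continuous_circle_measurable f : continuous f ->
  measurable_fun (setT : set (borel (circle R))) (f : borel (circle R) -> R).
Proof.
move=> /continuousP cf; apply: (measurability _ (RGenOpens.measurableE R)).
move=> _ [_ [a [b ->] <-]]; rewrite setTI; apply: sub_sigma_algebra.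
exact/cf/interval_open.
Qed.

Lemma circle_repr_itv (z : circle R) : exists2 x, x \in `[0, 1] & z = pi_ x.
Proof.
exists (repr z - (Num.floor (repr z))%:~R).
  rewrite in_itv/= subr_ge0 ge_floor lerBlDl ltW//.
  by rewrite -intrD1 floorD1_gt.
rewrite -[LHS]reprK; apply/eqP; rewrite circle_eqE opprB addrC subrK.
exact: intr_int.
Qed.

Lemma pi_circle_eq x y : x - y \is a Num.int -> pi_ x = pi_ y.
Proof. by move=> xy; apply/eqP; rewrite circle_eqE. Qed.

Lemma compact_circle : compact [set: circle R].
Proof.
have -> : [set: circle R] = pi_ @` `[0, 1].
  apply/seteqP; split => // z _.
  by have [x x01 ->] := circle_repr_itv z; exists x.
apply: continuous_compact; last exact: segment_compact.
exact/continuous_subspaceT/continuous_pi_circle.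
Qed.

Lemma circle_bounded f : continuous f -> exists B, forall z, `|f z| <= B.
Proof.
move=> cf; have cnf : {within [set: circle R], continuous (fun z => `|f z|)}.
  apply: continuous_subspaceT => z; apply: continuous_comp; first exact: cf.
  exact: norm_continuous.
have [|c _ cmax] := compact_EVT_max _ compact_circle cnf.
  by exists (0 : circle R).
by exists `|f c| => z; apply: cmax; exact: mem_set.
Qed.

Lemma circle_integrable f : continuous f ->
  (@circle_measure R).-integrable setT (EFin \o f).
Proof.
move=> cf; apply: measurable_bounded_integrable => //.
- rewrite [ltLHS](_ : _ = 1%E) ?ltry//.
  exact: (probability_setT (@circle_measure R)).
- exact: continuous_circle_measurable.
- have [B fB] := circle_bounded cf.
  exists B; split; first exact: num_real.
  by move=> M BM z _ /=; rewrite (le_trans (fB z))// ltW.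
Qed.

Definition circle_mean f : R := \int[@circle_measure R]_x f x.

Lemma circle_meanD f g : continuous f -> continuous g ->
  circle_mean (fun z => f z + g z) = circle_mean f + circle_mean g.
Proof. by move=> cf cg; apply: RintegralD => //; exact: circle_integrable. Qed.

Lemma circle_meanZ a f : continuous f ->
  circle_mean (fun z => a * f z) = a * circle_mean f.
Proof. by move=> cf; apply: RintegralZl => //; exact: circle_integrable. Qed.

Lemma circle_mean_cst a : circle_mean (fun=> a) = a.
Proof.
rewrite /circle_mean Rintegral_cst//= [X in fine X](_ : _ = 1%E) ?mulr1//.
exact: (probability_setT (@circle_measure R)).
Qed.

Lemma le_circle_mean f g : continuous f -> continuous g ->
  (forall z, f z <= g z) -> circle_mean f <= circle_mean g.
Proof. by move=> cf cg fg; apply: le_Rintegral => //; exact: circle_integrable. Qed.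

(** The integrality of [k] makes the value independent of the representative, as [wave_pi] shows;
    the phase covers cosines and sines together. *)
Definition wave (k : nat) (phi : R) (z : circle R) : R :=
  cos (2 * pi * (k%:R * repr z) + phi).

Lemma wave_pi k phi x : wave k phi (pi_ x) = cos (2 * pi * (k%:R * x) + phi).
Proof.
have /eqP := reprK (pi_ x); rewrite circle_eqE => /intrP[m xm].
rewrite /wave -[RHS](cosD2pi_int (k%:Z * m)) intrM -xm -pmulrn.
by congr cos; ring.
Qed.

Lemma continuous_wave k phi : continuous (wave k phi).
Proof.
apply: circle_continuous.
rewrite (_ : _ \o _ = cos \o (fun x => 2 * pi * (k%:R * x) + phi)); last first.
  by apply/funext => x /=; rewrite wave_pi.
move=> x; apply: continuous_comp; last exact: continuous_cos.
apply: cvgD; last exact: cvg_cst.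
by apply: cvgM; [exact: cvg_cst|apply: cvgM; [exact: cvg_cst|exact: cvg_id]].
Qed.

Lemma circle_mean_wave k phi : (0 < k)%N -> circle_mean (wave k phi) = 0.
Proof.
(* Adding 1 makes the integrand nonnegative, as [ge0_integral_distribution] requires. *)
move=> k0; apply: (addrI 1); rewrite addr0 -{1}(circle_mean_cst 1).
rewrite -circle_meanD; [|exact: cst_continuous|exact: continuous_wave].
have w0 z : (0 <= (1 + wave k phi z)%:E)%E.
  by rewrite lee_fin -lerBlDl sub0r cos_geN1.
have cw : continuous (fun z : circle R => 1 + wave k phi z).
  by apply: circle_continuousD; [exact: cst_continuous|exact: continuous_wave].
have mw : measurable_fun (setT : set (borel (circle R)))
    (fun z : borel (circle R) => (1 + wave k phi z)%:E).
  by apply/measurable_EFinP; exact: continuous_circle_measurable cw.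
rewrite /circle_mean /Rintegral (ge0_integral_distribution _ mw w0).
rewrite integral_uniform; last 2 first.
- exact: measurableT_comp mw (@measurable_to_circle R).
- by move=> x; exact: w0.
rewrite subr0 invr1 mul1e.
pose w : R := 2 * pi * k%:R.
have w_neq0 : w != 0 by rewrite gt_eqF // !mulr_gt0 ?pi_gt0 ?ltr0n.
have wE x : 2 * pi * (k%:R * x) = w * x by rewrite mulrA.
pose F x : R := x + w^-1 * sin (w * x + phi).
have dF x : is_derive x 1 F (1 + cos (w * x + phi)).
  apply: is_derive_eq.
  by rewrite /GRing.scale /= mulr1 addr0 mulrCA mulVf// mulr1.
have cF : continuous F.
  move=> x; apply/differentiable_continuous/derivable1_diffP.
  by case: (dF x).
under eq_integral do rewrite /= wave_pi wE.
rewrite (@continuous_FTC2 _ _ F)//=; last 2 first.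
- by split; [move=> x _; case: (dF x)|exact/cvg_at_right_filter/cF|
             exact/cvg_at_left_filter/cF].
- by move=> x _; rewrite derive1E; case: (dF x).
- have sinw : sin (w + phi) = sin phi.
    rewrite !sinE_cos (_ : w + phi - _ = phi - pi / 2 + 2 * pi * (k%:Z)%:~R).
      by rewrite cosD2pi_int.
    by rewrite -pmulrn /w; ring.
  by rewrite /F mulr1 mulr0 !add0r sinw; ring.
apply: continuous_subspaceT => x; apply: cvgD; first exact: cvg_cst.
apply: continuous_comp; last exact: continuous_cos.
apply: cvgD; last exact: cvg_cst.
by apply: cvgM; [exact: cvg_cst|exact: cvg_id].
Qed.

End circle_functions.

(** * A Korovkin estimate for continuous functions on the circle *)

Section weyl.
Variable R : realType.
Implicit Types (f : circle R -> R) (x y s e : R).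

Local Notation pi_ := (\pi_(circle R)%qT : R -> circle R).

Lemma circle_dist_eq0 x s : x \in `[0, 1] -> s \in `[0, 1] ->
  cos (2 * pi * (s - x)) = 1 -> pi_ s = pi_ x.
Proof.
wlog xs : x s / x <= s => [hw|].
  have [/hw//|/ltW sx] := leP x s.
  move=> x01 s01 c1; apply/esym/(hw s x) => //.
  by rewrite -cosN -[RHS]c1; congr cos; ring.
rewrite !in_itv/= => /andP[x0 x1] /andP[s0 s1] c1.
apply: pi_circle_eq.
have [->|sx] := eqVneq s x; first by rewrite subrr.
have [d1|d1] := ltP (s - x) 1.
  have : 0 < s - x < 1 by rewrite subr_gt0 lt_neqAle eq_sym sx xs.
  by move/cos2pi_lt1; rewrite c1 ltxx.
have -> : s - x = 1 by lra.
exact: rpred1.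
Qed.

(** [1 - cos (2 pi (s - x))] acts as a squared distance. On the compact set of pairs where [f]
    oscillates by at least [e] it has a positive minimum, so a large multiple of it dominates the
    oscillation. *)
Lemma circle_korovkin f e : continuous f -> 0 < e ->
  exists2 C, 0 <= C & forall x s,
    `|f (pi_ s) - f (pi_ x)| <= e + C * (1 - cos (2 * pi * (s - x))).
Proof.
move=> cf e0; have [B fB] := circle_bounded cf.
have B0 : 0 <= B by exact: le_trans (fB 0).
pose u (p : R * R) := `|f (pi_ p.2) - f (pi_ p.1)|.
pose v (p : R * R) := 1 - cos (2 * pi * (p.2 - p.1)).
have v0 p : 0 <= v p by rewrite subr_ge0 cos_le1.
pose I2 : set (R * R) := `[0, 1] `*` `[0, 1].
have cfpi : continuous (f \o pi_).
  by move=> x; apply: continuous_comp; [exact: continuous_pi_circle|exact: cf].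
have cu : continuous u.
  move=> p; apply: cvg_norm.
  apply: cvgB.
    by apply: (@continuous_comp _ _ _ snd (f \o pi_)); [exact: cvg_snd|exact: cfpi].
  by apply: (@continuous_comp _ _ _ fst (f \o pi_)); [exact: cvg_fst|exact: cfpi].
have cv : continuous v.
  move=> p; apply: cvgB; first exact: cvg_cst.
  apply: continuous_comp; last exact: continuous_cos.
  by apply: cvgM; [exact: cvg_cst|apply: cvgB; [exact: cvg_snd|exact: cvg_fst]].
pose K := I2 `&` u @^-1` [set y | e <= y].
have cK : compact K.
  apply: compact_closedI; first by apply: compact_setX; exact: segment_compact.
  apply: closed_comp; last exact: closed_ge.
  by move=> p _; exact: cu.
have [C C0 CP] : exists2 C, 0 <= C & forall p, I2 p -> u p <= e + C * v p.
  have [K0|K0] := pselect (K !=set0); last first.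
    exists 0 => // p Ip; rewrite mul0r addr0 leNgt; apply/negP => ep.
    by apply: K0; exists p; split => //; exact: ltW.
  have [|c cK' cmin] := compact_EVT_min K0 cK (f := v).
    exact: continuous_subspaceT.
  have vc0 : 0 < v c.
    rewrite lt_neqAle v0 andbT; apply/negP => /eqP vc0.
    move: cK' => /set_mem [[c1 c2] /= ec].
    have : pi_ c.2 = pi_ c.1.
      by apply: circle_dist_eq0 => //; move: vc0; rewrite /v; lra.
    by move=> h; move: ec; rewrite /u h subrr normr0 leNgt e0.
  (* The oscillation never exceeds [2 * B], and [v] is at least [v c] on [K]. *)
  exists (2 * B / v c) => [|p Ip]; first by rewrite divr_ge0 ?mulr_ge0// ltW.
  have [ep|ep] := leP e (u p); last first.
    by rewrite (le_trans (ltW ep))// lerDl mulr_ge0// divr_ge0 ?mulr_ge0// ltW.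
  have vcp : v c <= v p by apply: cmin; apply/mem_set.
  have : 2 * B / v c * v c <= 2 * B / v c * v p.
    by rewrite ler_wpM2l// divr_ge0 ?mulr_ge0// ltW.
  rewrite divfK ?gt_eqF// => h.
  have : u p <= `|f (pi_ p.2)| + `|f (pi_ p.1)| by exact: ler_normB.
  by have := fB (pi_ p.2); have := fB (pi_ p.1); lra.
exists C => // x s.
have [x' x01 xx'] := circle_repr_itv (pi_ x).
have [s' s01 ss'] := circle_repr_itv (pi_ s).
have := CP (x', s') (conj x01 s01); rewrite /u /v /= -xx' -ss'.
have /intrP[m xm] : x - x' \is a Num.int by rewrite -circle_eqE xx'.
have /intrP[n sn] : s - s' \is a Num.int by rewrite -circle_eqE ss'.
rewrite -(cosD2pi_int (n - m)) intrB -sn -xm.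
by rewrite (_ : 2 * pi * (s' - x') + _ = 2 * pi * (s - x)); last by ring.
Qed.

End weyl.

(** * Reduction of complex test functions to real ones *)

Section complex_topology.
Variable R : realType.
Local Open Scope complex_scope.

Lemma complex_norm_ge (z : R[i]) :
  (`|complex.Re z|%:C <= `|z|) /\ (`|complex.Im z|%:C <= `|z|).
Proof.
rewrite normc_def !lecR -!sqrtr_sqr !ler_wsqrtr//.
  by rewrite lerDr sqr_ge0.
by rewrite lerDl sqr_ge0.
Qed.

Lemma continuous_Re : continuous (fun z : R[i]^o => complex.Re z : R).
Proof.
move=> z; apply/(@cvgrPdist_lt _ _ _ (nbhs (z : R[i]^o))) => e e0.
have e0C : 0 < e%:C by rewrite -[0]/(0%:C) ltcR.
have := nbhsx_ballx (z : R[i]^o) _ e0C; rewrite -ball_normE.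
apply: filterS => w /= zw; rewrite -ltcR (le_lt_trans _ zw)//.
have := (complex_norm_ge (z - w)).1; case: z w {zw} => [a b] [c d]; exact.
Qed.

Lemma continuous_Im : continuous (fun z : R[i]^o => complex.Im z : R).
Proof.
move=> z; apply/(@cvgrPdist_lt _ _ _ (nbhs (z : R[i]^o))) => e e0.
have e0C : 0 < e%:C by rewrite -[0]/(0%:C) ltcR.
have := nbhsx_ballx (z : R[i]^o) _ e0C; rewrite -ball_normE.
apply: filterS => w /= zw; rewrite -ltcR (le_lt_trans _ zw)//.
have := (complex_norm_ge (z - w)).2; case: z w {zw} => [a b] [c d]; exact.
Qed.

Lemma normc_real (a : R) : `|a%:C| = `|a|%:C.
Proof. by rewrite normc_def /= expr0n addr0 sqrtr_sqr. Qed.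

Lemma continuous_real_complex : continuous (fun a : R => a%:C : R[i]^o).
Proof.
move=> a; apply/(@cvgrPdist_lt _ _ _ (nbhs a)) => -[e e'] ee.
(* In the order of [R[i]] a positive element is real. *)
have [/eqP e'0 e0] : e' == 0 /\ 0 < e by move: ee; rewrite ltcE => /andP.
have := nbhsx_ballx a _ e0; rewrite -ball_normE.
by apply: filterS => b /= ab; rewrite -rmorphB normc_real e'0 ltcR.
Qed.

Lemma cvg_complex (u : nat -> R[i]) (a b : R) :
  (u n : R[i]^o) @[n --> \oo] --> (a +i* b : R[i]^o) <->
  (complex.Re (u n) @[n --> \oo] --> a /\ complex.Im (u n) @[n --> \oo] --> b).
Proof.
split=> [h|[ha hb]].
  split; first exact: continuous_cvg (@continuous_Re _) h.
  exact: continuous_cvg (@continuous_Im _) h.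
rewrite [X in _ --> X](complexE (a +i* b)).
rewrite (_ : (fun n => u n : R[i]^o) =
    (fun n => (complex.Re (u n))%:C + 'i * (complex.Im (u n))%:C : R[i]^o)).
  apply: cvgD; first exact: continuous_cvg (@continuous_real_complex _) ha.
  apply: cvgM; first exact: cvg_cst.
  exact: continuous_cvg (@continuous_real_complex _) hb.
by apply/funext => n; exact: complexE.
Qed.

Lemma Re_mean (u : nat -> R[i]) N :
  complex.Re (N%:R^-1 * \sum_(1 <= n < N.+1) u n) =
  N%:R^-1 * \sum_(1 <= n < N.+1) complex.Re (u n).
Proof.
have <- : complex.Re (\sum_(1 <= n < N.+1) u n) =
    \sum_(1 <= n < N.+1) complex.Re (u n).
  by apply: (big_morph (@complex.Re R)) => // -[a b] [c d].
rewrite -(rmorph_nat (real_complex R)) -fmorphV.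
by case: (\sum_(_ <= _ < _) _) => a b /=; rewrite mul0r subr0.
Qed.

Lemma Im_mean (u : nat -> R[i]) N :
  complex.Im (N%:R^-1 * \sum_(1 <= n < N.+1) u n) =
  N%:R^-1 * \sum_(1 <= n < N.+1) complex.Im (u n).
Proof.
have <- : complex.Im (\sum_(1 <= n < N.+1) u n) =
    \sum_(1 <= n < N.+1) complex.Im (u n).
  by apply: (big_morph (@complex.Im R)) => // -[a b] [c d].
rewrite -(rmorph_nat (real_complex R)) -fmorphV.
by case: (\sum_(_ <= _ < _) _) => a b /=; rewrite mul0r addr0.
Qed.

Lemma ud_mod1_realP (x : nat -> circle R) : ud_mod1 x <->
  forall f : circle R -> R, continuous f ->
    mean0 (fun n => f (x n) - circle_mean f).
Proof.
split=> [hx f cf|hx f cf].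
  have cfC : continuous (fun z => (f z)%:C : R[i]^o).
    by move=> z; apply: continuous_comp; [exact: cf|exact: continuous_real_complex].
  apply/mean0_subP; have /cvg_complex[/= h _] := hx _ cfC.
  by apply: eq_cvg_seq h => N; rewrite Re_mean.
apply/cvg_complex; split.
  have cRe : continuous (fun z => complex.Re (f z) : R).
    by move=> z; apply: continuous_comp; [exact: cf|exact: continuous_Re].
  by apply: eq_cvg_seq ((mean0_subP _ _).1 (hx _ cRe)) => N; rewrite Re_mean.
have cIm : continuous (fun z => complex.Im (f z) : R).
  by move=> z; apply: continuous_comp; [exact: cf|exact: continuous_Im].
by apply: eq_cvg_seq ((mean0_subP _ _).1 (hx _ cIm)) => N; rewrite Im_mean.
Qed.

End complex_topology.

(** * Weyl's criterion on the circle *)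

Section weyl_criterion.
Variable R : realType.
Implicit Types (f g : circle R -> R).

Local Notation pi_ := (\pi_(circle R)%qT : R -> circle R).

(** Entries hold coefficient, frequency minus one and phase; the successor rules out frequency 0, so
    these sums have mean 0. *)
Definition trig (s : seq (R * nat * R)) (z : circle R) : R :=
  \sum_(t <- s) t.1.1 * wave t.1.2.+1 t.2 z.

Definition is_trig g := exists c s, forall z, g z = c + trig s z.

Lemma is_trigD f g : is_trig f -> is_trig g -> is_trig (fun z => f z + g z).
Proof.
move=> [c [s hf]] [d [r hg]]; exists (c + d), (s ++ r) => z.
by rewrite hf hg /trig big_cat addrACA.
Qed.

Lemma is_trig_cst a : is_trig (fun=> a).
Proof. by exists a, [::] => z; rewrite /trig big_nil addr0. Qed.

Lemma is_trigZ a f : is_trig f -> is_trig (fun z => a * f z).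
Proof.
move=> [c [s hf]]; exists (a * c), [seq (a * t.1.1, t.1.2, t.2) | t <- s] => z.
rewrite hf mulrDr /trig big_map mulr_sumr; congr (_ + _).
by apply: eq_bigr => t _; rewrite mulrA.
Qed.

Lemma is_trig_sum (I : Type) (r : seq I) (F : I -> circle R -> R) :
  (forall i, is_trig (F i)) -> is_trig (fun z => \sum_(i <- r) F i z).
Proof.
move=> hF; elim: r => [|i r IH].
  rewrite (_ : (fun _ => _) = (fun=> 0)); first exact: is_trig_cst.
  by apply/funext => z; rewrite big_nil.
rewrite (_ : (fun _ => _) = (fun z => F i z + \sum_(i <- r) F i z)).
  exact: is_trigD.
by apply/funext => z; rewrite big_cons.
Qed.

Lemma is_trig_cosB (k l : nat) phi :
  is_trig (fun z => cos ((k%:R - l%:R) * (2 * pi * (repr z - phi)))).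
Proof.
have [kl|lk|->] := ltngtP k l.
- exists 0, [:: (1, (l - k).-1, - ((l%:R - k%:R) * (2 * pi * phi)))] => z.
  rewrite /trig big_seq1 add0r mul1r /wave prednK ?subn_gt0// natrB 1?ltnW//=.
  by rewrite -cosN; congr cos; ring.
- exists 0, [:: (1, (k - l).-1, - ((k%:R - l%:R) * (2 * pi * phi)))] => z.
  rewrite /trig big_seq1 add0r mul1r /wave prednK ?subn_gt0// natrB 1?ltnW//=.
  by congr cos; ring.
- exists 1, [::] => z.
  by rewrite /trig big_nil addr0 subrr mul0r cos0.
Qed.

Lemma is_trig_fejer n phi : is_trig (fun z => fejer n (2 * pi * (repr z - phi))).
Proof.
rewrite (_ : (fun _ => _) = fun z => n%:R^-1 * \sum_(k < n) \sum_(l < n)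
    cos ((k%:R - l%:R) * (2 * pi * (repr z - phi)))).
  by apply: is_trigZ; apply: is_trig_sum => k; apply: is_trig_sum => l;
    exact: is_trig_cosB.
by apply/funext => z; rewrite fejerE.
Qed.

(* Convolution with the Fejer kernel, discretized on a grid that its frequencies
   do not see. *)
Lemma trig_approx f e : continuous f -> 0 < e ->
  exists2 g, is_trig g & forall z, `|f z - g z| <= e.
Proof.
move=> cf e0; have e2 : 0 < e / 2 by rewrite divr_gt0.
have [C C0 kor] := circle_korovkin cf e2.
(* With [4 * C <= e * n] the kernel tail [2 * C / n] is at most [e / 2]. *)
have [N0 /(_ N0.+1 (leqnSn _)) CN] := nat_ge_divr (4 * C) e0.
set n := N0.+1 in CN; have n0 : 0 < n%:R :> R by rewrite ltr0n.
pose F (i : 'I_n) (z : circle R) := fejer n (2 * pi * (repr z - i%:R / n%:R)).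
have F1 z : n%:R^-1 * \sum_(i < n) F i z = 1 by exact: mean_fejer_grid.
exists (fun z => n%:R^-1 * \sum_(i < n) f (pi_ (i%:R / n%:R)) * F i z).
  apply: is_trigZ; apply: is_trig_sum => i; apply: is_trigZ.
  exact: is_trig_fejer.
(* The weights [F i z] are nonnegative with average 1, so [f z - g z] is an average of the
   differences [f z - f (i / n)]. *)
move=> z; have fE : f z = n%:R^-1 * (f z * \sum_(i < n) F i z).
  by rewrite mulrCA F1 mulr1.
rewrite {1}fE -mulrBr mulr_sumr -sumrB.
rewrite normrM ger0_norm ?invr_ge0// ler_pdivrMl//.
rewrite (le_trans (ler_norm_sum _ _ _))//.
apply: (@le_trans _ _ (\sum_(i < n) (e / 2 * F i z + C * (2 / n%:R)))).
  apply: ler_sum => i _; rewrite -mulrBl normrM (ger0_norm (fejer_ge0 _ _)).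
  have := kor (i%:R / n%:R) (repr z); rewrite reprK => h.
  rewrite (le_trans (ler_wpM2r (fejer_ge0 _ _) h))// mulrDl lerD2l.
  by rewrite -[leLHS]mulrA ler_wpM2l// mulrC fejer_le.
rewrite big_split/= -mulr_sumr sumr_const card_ord -[(C * _) *+ n]mulr_natl.
have -> : \sum_(i < n) F i z = n%:R.
  apply: (@mulfI _ n%:R^-1); first by rewrite invr_eq0 gt_eqF.
  by rewrite F1 mulVf// gt_eqF.
have -> : n%:R * (C * (2 / n%:R)) = 2 * C by field; rewrite gt_eqF.
by move: (n%:R : R) CN => r; lra.
Qed.

Lemma circle_mean_dist f g e : continuous f -> continuous g ->
  (forall z, `|f z - g z| <= e) -> `|circle_mean f - circle_mean g| <= e.
Proof.
have le1 f1 g1 : continuous f1 -> continuous g1 ->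
    (forall z, `|f1 z - g1 z| <= e) -> circle_mean f1 - circle_mean g1 <= e.
  move=> cf cg fg; rewrite lerBlDr -(circle_mean_cst e) -circle_meanD//.
    apply: le_circle_mean => //.
      by apply: circle_continuousD => //; exact: cst_continuous.
    by move=> z; rewrite -lerBlDr (le_trans (ler_norm _)).
  exact: cst_continuous.
move=> cf cg fg; rewrite ler_norml lerNl opprB !le1// => z.
by rewrite distrC.
Qed.

Lemma continuous_trig s : continuous (trig s).
Proof.
elim: s => [|t s IH].
  rewrite (_ : trig _ = fun=> 0); first exact: cst_continuous.
  by apply/funext => z; rewrite /trig big_nil.
rewrite (_ : trig _ = fun z => t.1.1 * wave t.1.2.+1 t.2 z + trig s z).
  by apply: circle_continuousD => //; apply: circle_continuousZ; exact: continuous_wave.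
by apply/funext => z; rewrite /trig big_cons.
Qed.

Lemma circle_mean_trig s : circle_mean (trig s) = 0.
Proof.
elim: s => [|t s IH].
  rewrite (_ : trig _ = fun=> 0); first exact: circle_mean_cst.
  by apply/funext => z; rewrite /trig big_nil.
rewrite (_ : trig _ = fun z => t.1.1 * wave t.1.2.+1 t.2 z + trig s z).
  rewrite circle_meanD ?circle_meanZ ?circle_mean_wave ?IH ?mulr0 ?addr0//.
  - exact: continuous_wave.
  - by apply: circle_continuousZ; exact: continuous_wave.
  - exact: continuous_trig.
by apply/funext => z; rewrite /trig big_cons.
Qed.

Lemma mean0_trig (x : nat -> circle R) s :
  (forall k phi, (0 < k)%N -> mean0 (fun n => wave k phi (x n))) ->
  mean0 (fun n => trig s (x n)).
Proof.
move=> hx; elim: s => [|t s IH].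
  apply: eq_mean0 (mean0Z 0 (hx 1%N 0 isT)) => n _.
  by rewrite /trig big_nil mul0r.
apply: eq_mean0 (mean0D (mean0Z t.1.1 (hx t.1.2.+1 t.2 isT)) IH) => n _.
by rewrite /trig big_cons.
Qed.

Lemma ud_mod1_waveP (x : nat -> circle R) : ud_mod1 x <->
  forall k phi, (0 < k)%N -> mean0 (fun n => wave k phi (x n)).
Proof.
split=> [/ud_mod1_realP hx k phi k0|hx].
  apply: eq_mean0 (hx _ (@continuous_wave R k phi)) => n _.
  by rewrite circle_mean_wave// subr0.
apply/ud_mod1_realP => f cf; apply/mean0P => e e0.
have e3 : 0 < e / 3 by rewrite divr_gt0.
have [_ [c [s /funext ->]] fg] := trig_approx cf e3.
have cc : continuous (fun _ : circle R => c) by exact: cst_continuous.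
have ct := @continuous_trig s.
have cg := circle_continuousD cc ct.
have mg : circle_mean (fun z => c + trig s z) = c.
  by rewrite circle_meanD// circle_mean_cst circle_mean_trig addr0.
have fc : `|c - circle_mean f| <= e / 3.
  by rewrite -mg; apply: circle_mean_dist => // z; rewrite distrC.
have [N0 N0P] := (mean0P _).1 (mean0_trig s hx) _ e3.
exists N0 => N NN0; have {N0P} h := N0P N NN0.
have sumle (u : nat -> R) : (forall n, `|u n| <= e / 3) ->
    `|\sum_(1 <= n < N.+1) u n| <= e / 3 * N%:R.
  move=> hu; rewrite (le_trans (ler_norm_sum _ _ _))//.
  rewrite (le_trans (ler_sum _ (fun n _ => hu n)))//.
  by rewrite sumr_const_nat subSS subn0 mulr_natr.
(* Three errors of [e / 3] each: approximation at the points, approximation of the mean, and the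
   average of the trigonometric part. *)
rewrite (eq_bigr (fun n => (f (x n) - (c + trig s (x n))) + (c - circle_mean f)
  + trig s (x n))); last by move=> n _; ring.
rewrite big_split/= big_split/= (_ : e * _ = e / 3 * N%:R + e / 3 * N%:R + e / 3 * N%:R).
  rewrite (le_trans (ler_normD _ _))// lerD//.
  rewrite (le_trans (ler_normD _ _))//.
  by apply: lerD; apply: sumle => n; [exact: fg|exact: fc].
by field.
Qed.

End weyl_criterion.

(** * From van der Corput sets to the two-element group *)

Section vdC_to_Z2.
Variable R : realType.

Local Notation pi_ := (\pi_(circle R)%qT : R -> circle R).

(* [cosp k true] and [cosp k false] are [x |-> cos (2 pi k x)] and
   [x |-> sin (2 pi k x)]. *)
Definition phase (b : bool) : R := if b then 0 else - (pi / 2).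
Definition cosp (k : nat) (b : bool) (x : R) : R :=
  cos (2 * pi * (k%:R * x) + phase b).

Lemma cosp_true k x : cosp k true x = cos (2 * pi * (k%:R * x)).
Proof. by rewrite /cosp addr0. Qed.

Lemma cosp_false k x : cosp k false x = sin (2 * pi * (k%:R * x)).
Proof. by rewrite /cosp cosBpihalf. Qed.

Lemma norm_cosp k b x : `|cosp k b x| <= 1. Proof. exact: cos_max. Qed.

Lemma cos_phase b : cos (phase b) = b%:R.
Proof. by case: b; rewrite /phase ?cos0// cosN cos_pihalf. Qed.

(** Separates the two points, so that Fourier averages of differences become correlations of the
    [cosp]. *)
Lemma wave_subE k phi x y : wave k phi (pi_ x - pi_ y) =
  cos phi * (cosp k true x * cosp k true y + cosp k false x * cosp k false y) -
  sin phi * (cosp k false x * cosp k true y - cosp k true x * cosp k false y).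
Proof.
rewrite -pi_circleB wave_pi cosD !cosp_true !cosp_false -cosB -sinB.
rewrite (_ : 2 * pi * (k%:R * (x - y)) =
  2 * pi * (k%:R * x) - 2 * pi * (k%:R * y)); last by ring.
by rewrite [cos phi * _]mulrC [sin phi * _]mulrC.
Qed.

(* The law with weights [1 + y cos (2 pi j / M)] on the grid [j / M] has
   Fourier coefficient [y / 2] at 1 and 0 at the other small frequencies. *)
Lemma sum_weighted_cosp (M k : nat) (y : R) b : (0 < k)%N -> (k.+1 < M)%N ->
  \sum_(j < M) (1 + y * cosp 1 true (j%:R / M%:R)) * cosp k b (j%:R / M%:R) =
  M%:R * ((k == 1%N) && b)%:R * y / 2.
Proof.
move=> k0 kM.
transitivity (\sum_(j < M) cos (phase b + 2 * pi * (k%:R * (j%:R / M%:R))) +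
  y / 2 * (\sum_(j < M) cos (phase b + 2 * pi * (k.-1%:R * (j%:R / M%:R))) +
           \sum_(j < M) cos (phase b + 2 * pi * (k.+1%:R * (j%:R / M%:R))))).
  rewrite -big_split mulr_sumr -big_split; apply: eq_bigr => j _ /=.
  rewrite cosp_true /cosp mul1r; set t := 2 * pi * (j%:R / M%:R).
  have -> : 2 * pi * (k%:R * (j%:R / M%:R)) + phase b = phase b + k%:R * t.
    by rewrite /t; ring.
  have -> : 2 * pi * (k%:R * (j%:R / M%:R)) = k%:R * t by rewrite /t; ring.
  have -> : phase b + 2 * pi * (k.-1%:R * (j%:R / M%:R)) = phase b + k%:R * t - t.
    by rewrite -[in k%:R](prednK k0) -(natr1 k.-1) /t; ring.
  have -> : phase b + 2 * pi * (k.+1%:R * (j%:R / M%:R)) = phase b + k%:R * t + t.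
    by rewrite -(natr1 k) /t; ring.
  by rewrite [cos (_ + t)]cosD cosB; field.
rewrite sum_cos_grid ?(sum_cos_grid (k := k.+1)) ?k0 ?(ltnW kM)// add0r addr0.
have [->|k1] := eqVneq k 1%N.
  rewrite /= (eq_bigr (fun=> b%:R)).
    by rewrite sumr_const card_ord -mulr_natl; ring.
  by move=> j _; rewrite mul0r mulr0 addr0 cos_phase.
by rewrite sum_cos_grid ?mulr0 ?mul0r//; lia.
Qed.

Lemma sum_weights (M : nat) (y : R) : (1 < M)%N ->
  \sum_(j < M) (1 + y * cosp 1 true (j%:R / M%:R)) = M%:R.
Proof.
move=> M1; rewrite big_split/= sumr_const card_ord -mulr_sumr.
rewrite (eq_bigr (fun j : 'I_M => cos (0 + 2 * pi * (1%:R * (j%:R / M%:R))))).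
  by rewrite sum_cos_grid// mulr0 addr0.
by move=> j _; rewrite cosp_true add0r.
Qed.

(** The expectation argument: if all [S j] were positive, a zero weighted sum would force all
    weights to vanish. *)
Lemma weighted_choice (n : nat) (W S : 'I_n -> R) :
  (forall j, 0 <= W j) -> 0 < \sum_j W j -> \sum_j W j * S j = 0 ->
  exists j, S j <= 0.
Proof.
move=> W0 sW sWS; apply/not_existsP => h.
have S0 j : 0 < S j by rewrite ltNge; apply/negP/h.
move: sW; rewrite big1 ?ltxx// => j _.
have : \sum_j W j * S j == 0 by rewrite sWS.
rewrite psumr_eq0 => [/allP/(_ j (mem_index_enum j))|i _].
  by rewrite /= mulf_eq0 (gt_eqF (S0 j)) orbF => /eqP.
by rewrite mulr_ge0// ltW.
Qed.

Section randomize.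
Variable z : nat -> Z2.

Let y n := Z2sign R (z n).

(** The expectation of [cosp k b] under the law of density [1 + y n cos (2 pi x)], for [k]
    positive. *)
Definition cosp_mean k b n : R := ((k == 1%N) && b)%:R * y n / 2.

Lemma norm_cosp_mean k b n : `|cosp_mean k b n| <= 1.
Proof.
rewrite /cosp_mean !normrM Z2sign_norm mulr1 normr_nat.
by rewrite gtr0_norm ?invr_gt0//; case: (_ && _); rewrite /=; lra.
Qed.

(** The traces of independence needed below: deviations from the expectation average out alone,
    against the given signs, and against earlier points. *)
Lemma randomized_points : exists X : nat -> R, forall k b, (0 < k)%N -> [/\
  mean0 (fun n => cosp k b (X n) - cosp_mean k b n),
  (forall h, mean0 (fun n => (cosp k b (X n) - cosp_mean k b n) * y (n + h)%N)) &
  (forall h b', (0 < h)%N -> mean0 (fun n =>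
    (cosp k b (X (n + h)%N) - cosp_mean k b (n + h)%N) * cosp k b' (X n)))].
Proof.
pose g (k : nat) (i : option (nat * option bool)) (s : seq R) : R :=
  match i with
  | None => 1
  | Some (h, None) => y (size s + h)%N
  | Some (h, Some b') => cosp k b' (nth 0 s (size s - h))
  end.
have g1 k i s : `|g k i s| <= 1.
  case: i => [[h [b'|]]|] /=; rewrite ?normr1 ?norm_cosp//.
  by rewrite Z2sign_norm.
(* The first component is the frequency minus one, so only positive frequencies are tested. *)
pose I : countType := (nat * bool * option (nat * option bool))%type.
pose D (i : I) (s : seq R) (t : R) :=
  (cosp i.1.1.+1 i.1.2 t - cosp_mean i.1.1.+1 i.1.2 (size s)) * g i.1.1.+1 i.2 s.
have D2 i s t : `|D i s t| <= 2.
  rewrite normrM -[leRHS]mulr1 ler_pM// (le_trans (ler_normB _ _))//.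
  by rewrite -[2]/(1 + 1) lerD ?norm_cosp ?norm_cosp_mean.
have [//|s r l|X XP] := greedy_mean0 _ D2.
  (* Only finitely many tests matter at one step; this grid is fine enough for their expectations to
     be exact, the shift by 3 giving [k.+1 < M] for every tested frequency [k]. *)
  pose M := (\max_(i <- r) (i : I).1.1 + 3)%N.
  have M0 : (1 < M)%N by rewrite /M; lia.
  have kM i : i \in r -> ((i : I).1.1.+2 < M)%N.
    move=> ir; rewrite /M addnS ltnS addn2 !ltnS.
    by rewrite (big_rem _ ir) leq_maxl.
  pose W (j : 'I_M) := 1 + y (size s) * cosp 1 true (j%:R / M%:R).
  pose S (j : 'I_M) := \sum_(i <- r) l i * D i s (j%:R / M%:R).
  have [|||j hj] := @weighted_choice M W S.
  - move=> j; rewrite /W; have : `|y (size s) * cosp 1 true (j%:R / M%:R)| <= 1.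
      by rewrite normrM Z2sign_norm mul1r norm_cosp.
    by rewrite ler_norml => /andP[? _]; lra.
  - by rewrite sum_weights// ltr0n; lia.
  - under eq_bigr do rewrite mulr_sumr.
    rewrite exchange_big/= big_seq big1// => i ir.
    rewrite (eq_bigr (fun j => l i * g i.1.1.+1 i.2 s *
      (W j * cosp i.1.1.+1 i.1.2 (j%:R / M%:R) -
       W j * cosp_mean i.1.1.+1 i.1.2 (size s)))); last by move=> j _; rewrite /D; ring.
    rewrite -mulr_sumr sumrB sum_weighted_cosp ?kM// -mulr_suml sum_weights//.
    by rewrite /cosp_mean -/(y _) !mulrA subrr mulr0.
  by exists (j%:R / M%:R).
exists X => -[//|k] b _; split.
- by apply: eq_mean0 (XP (k, b, None)) => n _; rewrite /D /= size_mkseq mulr1.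
- move=> h; apply: eq_mean0 (XP (k, b, Some (h, None))) => n _.
  by rewrite /D /= size_mkseq.
- move=> h b' h0.
  have := mean0_shift h (fun n => D2 _ _ _) (XP (k, b, Some (h, Some b'))).
  apply: eq_mean0 => n _; rewrite /D /= size_mkseq addnK nth_mkseq//.
  by rewrite -[X in (X < _)%N]addn0 ltn_add2l.
Qed.

End randomize.

Lemma vdC_ud_vdC_Z2 (H : set nat) : (forall h, H h -> (0 < h)%N) ->
  vdC R H -> ud_vdC (haar_Z2 R) H.
Proof.
move=> H0 hvdC z hz; apply/ud_Z2P.
pose y n := Z2sign R (z n).
have hy h : H h -> mean0 (fun n => y (n + h)%N * y n).
  move=> Hh; apply: eq_mean0 ((ud_Z2P _ _).1 (hz h Hh)) => n _.
  by rewrite Z2signMV.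
have [X XP] := randomized_points z.
suff : ud_mod1 (fun n => pi_ (X n)).
  move=> /ud_mod1_waveP/(_ 1%N 0 isT) hw.
  have [h1 _ _] := XP 1%N true isT.
  apply: eq_mean0 (mean0Z 2 (mean0B hw h1)) => n _.
  by rewrite wave_pi /cosp /phase /cosp_mean /= -/(y n); field.
apply: hvdC => h Hh; apply/ud_mod1_waveP => k phi k0.
(* Each factor is replaced by its expectation in turn, the later point first; what remains is a
   multiple of [y (n + h) * y n]. *)
have prod b b' : mean0 (fun n => cosp k b (X (n + h)%N) * cosp k b' (X n)).
  have [_ _ /(_ h b' (H0 h Hh)) t3] := XP k b k0.
  have [_ /(_ h) t2 _] := XP k b' k0.
  pose d (c : bool) : R := ((k == 1%N) && c)%:R / 2.
  have := mean0D (mean0D t3 (mean0Z (d b) t2)) (mean0Z (d b * d b') (hy h Hh)).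
  apply: eq_mean0 => n _; rewrite /cosp_mean /d -/(y n) -/(y (n + h)%N).
  by ring.
have := mean0B (mean0Z (cos phi) (mean0D (prod true true) (prod false false)))
  (mean0Z (sin phi) (mean0B (prod false true) (prod true false))).
by apply: eq_mean0 => n _; rewrite wave_subE.
Qed.

End vdC_to_Z2.

(** * From the two-element group to van der Corput sets, and the equivalence *)

Lemma ud_vdC_Z2_vdC (R : realType) (H : set nat) :
  (forall h, H h -> (0 < h)%N) -> ud_vdC (haar_Z2 R) H -> vdC R H.
Proof.
move=> H0 hZ2 x hx; apply/ud_mod1_waveP => k phi k0.
pose c n := cosp k true (repr (x n)); pose s n := cosp k false (repr (x n)).
(* The phase 0 average of the differences is the planar correlation of the points [(c n, s n)]. *)
have corr h : H h -> mean0 (fun n => c (n + h)%N * c n + s (n + h)%N * s n).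
  move=> Hh; apply: eq_mean0 ((ud_mod1_waveP _).1 (hx h Hh) k 0 k0) => n _.
  rewrite -[x (n + h)%N]reprK -[x n]reprK wave_subE cos0 sin0.
  by rewrite mul1r mul0r subr0.
have c1 n : `|c n| <= 1 := norm_cosp _ _ _.
have s1 n : `|s n| <= 1 := norm_cosp _ _ _.
have hc : mean0 c := ud_vdC_Z2_planar H0 hZ2 c1 s1 corr.
(* The planar correlation is symmetric in its coordinates, so the same lemma applies with them
   exchanged. *)
have hs : mean0 s.
  apply: (ud_vdC_Z2_planar H0 hZ2 s1 c1) => h /corr.
  by apply: eq_mean0 => n _; rewrite addrC.
apply: eq_mean0 (mean0B (mean0Z (cos phi) hc) (mean0Z (sin phi) hs)) => n _.
rewrite /wave cosD /c /s cosp_true cosp_false.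
by rewrite [cos phi * _]mulrC [sin phi * _]mulrC.
Qed.

Theorem proposition7p10 (R : realType) (H : set nat)
    (H_pos : forall h : nat, H h -> (0 < h)%N) :
  vdC R H <-> ud_vdC (haar_Z2 R) H.
Proof. by split; [exact: vdC_ud_vdC_Z2|exact: ud_vdC_Z2_vdC]. Qed.
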